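(* Let $(G,F)$ be a plane framed graph, let $\mathrm{h}$ be an admissible height function for the framed triangulation $\Delta_{G,F}$, and let $\mathbf{x}=\mathbf{x}(C)=(x_{i,j})_{(i,j)\in I}$ be the vertex of the tropical framingtope $\mathscr{P}^{\mathrm h}_{G,F}$ corresponding to a maximal clique $C$. Then, for every $(i,j)\in I$, $$x_{i,j}=\sum_{(k,l)\in\overline{D}(p_{i,j})}\bigl(\mathrm{h}(R_{k,l})-\mathrm{h}(R_{k,l}^{\downarrow})\bigr),$$ where $R_{k,l}=R_{k,l}(C)$, $R^{\downarrow}_{k,l}=R^{\downarrow}_{k,l}(C)$, and $\overline{D}(p_{i,j})$ is the set of indices $(k,l)$ such that $p_{k,l}\leq p_{i,j}$ and $p_{k,l}$ can be reached from $p_{i,j}$ by moving downward without crossing an edge of the form $e_{\star,0}$.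
   Context: Flow graphs. A flow graph $G$ is a finite directed acyclic graph (multiple edges allowed) with vertex set $[n]$ and edge multiset $E(G)$, all edges directed from smaller to larger vertices, with unique source $1$ and unique sink $n$. A route is a directed path from $1$ to $n$; $R(G)$ is the set of routes. The flow polytope $\mathcal{F}_G\subset\mathbb{R}^{E(G)}$ (unit flows from $1$ to $n$) is the convex hull of the $0/1$ indicator vectors of routes, which are its vertices. Framings and coherence. A framing $F$ is a choice, at every vertex $v$, of linear orders on the incoming edges $\mathrm{In}(v)$ and the outgoing edges $\mathrm{Out}(v)$. For a route $P$ through $v$ let $Pv$ (resp. $vP$) be its subpath ending (resp. beginning) at $v$. Let $w\le v$ be the smallest vertex after which $Pv$ and $Qv$ coincide; if $w$ is the first vertex of $Pv$ or $Qv$, then $Pv=_{\mathscr{I}(v)}Qv$; otherwise $Pv<_{\mathscr{I}(v)}Qv$ iff the edge of $P$ entering $w$ is smaller in $\mathrm{In}(w)$ than that of $Q$. Let $w'\ge v$ be the largest vertex before which $vP$ and $vQ$ coincide; if $w'$ is the last vertex of $vP$ or $vQ$, then $vP=_{\mathscr{O}(v)}vQ$; otherwise $vP<_{\mathscr{O}(v)}vQ$ iff the edge of $P$ leaving $w'$ is smaller in $\mathrm{Out}(w')$ than that of $Q$. Routes $P,Q$ are incoherent at a common inner vertex $v$ ($v\neq 1,n$) if $Pv<_{\mathscr{I}(v)}Qv$ and $vQ<_{\mathscr{O}(v)}vP$, or vice versa with $P,Q$ exchanged; coherent if incoherent at no common inner vertex. A maximal clique is an inclusion-maximal set of pairwise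 coherent routes. The convex hulls of (the indicator vectors of) maximal cliques are the top-dimensional simplices of a regular unimodular triangulation $\Delta_{G,F}$ of $\mathcal{F}_G$ (Danilov–Karzanov–Koshevoy), the framed triangulation. Plane framed graphs. $(G,F)$ is a plane framed graph if $G$ has a crossing-free embedding in the plane with vertices located from left to right in increasing order, edges oriented monotonically from left to right, and framing $F$ induced by the embedding (incoming and outgoing edges at each vertex ordered from top to bottom). Label the outgoing edges of vertex $i+1$ ($0\le i\le n-2$) from bottom to top by $e_{i,0},e_{i,1},\dots,e_{i,j_i}$; ''an edge of the form $e_{\star,0}$'' means the bottommost outgoing edge of some vertex. Every bounded region (bubble) of the embedding is bounded by two paths with the same starting vertex and the same ending vertex; it is denoted $p_{i,j}$ ($j\neq0$) where $e_{i,j}$ is the first edge of its upper boundary path. (This indexes the bubbles by the edges $e_{i,j}$ with $j\ne 0$.) Write $p\lessdot q$ if the bubbles $p,q$ share an edge and $p$ lies below $q$; the bubble poset $(P_{G,F},\leq)$ is the reflexive-transitive closure. Each route $R$ determines the order ideal $I_R$ of bubbles lying below it; this is a bijection between routes and order ideals, and maximal cliques correspond to maximal chains $I_0\subset I_1\subset\dots\subset I_d$ of order ideals, equivalently to linear extensions of $P_{G,F}$. For a maximal clique $C$ and $l\neq0$, $R_{k,l}(C)$ is the route of $C$ whose order ideal consists of $p_{k,l}$ and all elements preceding it in the linear extension of $C$ (equivalently, the first route, from bottom to top, of $C$ containing $e_{k,l}$), and $R^{\downarrow}_{k,l}(C)$ is the route of $C$ immediately preceding it (its order ideal lacks exactly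 $p_{k,l}$). ''Reached by moving downward without crossing an edge $e_{\star,0}$'' means: there are bubbles $p_{i,j}=q_0,q_1,\dots,q_m=p_{k,l}$, $m\ge0$, such that for each $t$ the bubbles $q_t$ and $q_{t+1}$ share an edge not of the form $e_{\star,0}$ with $q_{t+1}$ below $q_t$. Admissible height functions. $\mathrm h:R(G)\to\mathbb{R}$ is admissible for $\Delta_{G,F}$ if the regular subdivision of $\mathcal{F}_G$ obtained by lifting the indicator vector of each route $R$ to height $\mathrm h(R)$ and projecting the upper faces equals $\Delta_{G,F}$. Tropical framingtope. Let $I=\{(i,j):1\le i\le n-2,\ 1\le j\le j_i\}$; for a route $R$ let $\vec R\in\{0,1\}^I$ have $(i,j)$-coordinate $1$ iff $R$ uses $e_{i,j}$. For each source edge $e_{0,i}$, $0\le i\le j_0$, let $G_i$ be the union of all routes starting with $e_{0,i}$, with $e_{0,i}$ deleted, and let $T_i^{\mathrm h}(\mathbf{x})=\min\{-\mathrm h(e_{0,i}R)+\langle\vec R,\mathbf{x}\rangle:R\in R(G_i)\}$, $\mathbf{x}\in\mathbb{R}^I$, where $e_{0,i}R$ prepends $e_{0,i}$ to $R$. Each $T^{\mathrm h}_i$ decomposes $\mathbb{R}^I$ into cells according to which terms attain the minimum; $\mathscr{P}^{\mathrm h}_{G,F}$ is the complex of bounded cells of the common refinement of these decompositions. Its vertices correspond to maximal cliques: $\mathbf{x}(C)$ is the unique point such that for every $i\in\{0,\dots,j_0\}$ all routes of $C$ starting with $e_{0,i}$ attain the minimum in $T_i^{\mathrm h}$. *)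

(* Defs.v *)
From HB Require Import structures.
From mathcomp Require Import all_boot all_order all_algebra.
From mathcomp Require Import all_classical all_reals all_analysis.

Set Implicit Arguments.
Unset Strict Implicit.
Unset Printing Implicit Defensive.

Import Order.TTheory GRing.Theory Num.Theory.
Import numFieldNormedType.Exports.

Local Open Scope classical_set_scope.
Local Open Scope ring_scope.

(* Vertices are numbered from 0: the ordinal i : 'I_n.+1 is the vertex i + 1 of
   [n + 1], so that the edges e_{i,j} are those with tail i. *)
Record flow_graph (n : nat) := FlowGraph {
  edge :> finType;
  tail : edge -> 'I_n.+1;
  head : edge -> 'I_n.+1;
  tail_lt_head : forall e, (tail e < head e)%N;
  unique_source : forall v, (forall e, head e != v) <-> v = ord0;
  unique_sink : forall v, (forall e, tail e != v) <-> v = ord_max }.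

Arguments tail {n G} e : rename.
Arguments head {n G} e : rename.

Fixpoint is_path n (G : flow_graph n) (u : 'I_n.+1) (p : seq G)
    (w : 'I_n.+1) : bool :=
  if p is e :: p' then (tail e == u) && is_path (head e) p' w else u == w.

(* A path has at most n edges, so the length bound only serves to make the type
   of routes finite. *)
Record route n (G : flow_graph n) := Route {
  route_edges : n.-bseq G;
  route_path : is_path ord0 route_edges ord_max }.

Coercion route_seq n (G : flow_graph n) (P : route G) : seq G := route_edges P.

HB.instance Definition _ n (G : flow_graph n) :=
  [isSub for @route_edges n G].
HB.instance Definition _ n (G : flow_graph n) := [Finite of route G by <:].

Section Framing.
Context (n : nat) (G : flow_graph n).

Definition strict_linear_on (A : pred G) (r : rel G) : Prop :=
  [/\ {in A, irreflexive r}, {in A & &, transitive r}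
    & {in A &, forall e f, e != f -> r e f || r f e}].

Record framing := Framing {
  in_lt : 'I_n.+1 -> rel G;
  out_lt : 'I_n.+1 -> rel G;
  in_lt_linear : forall v, strict_linear_on [pred e | head e == v] (in_lt v);
  out_lt_linear :
    forall v, strict_linear_on [pred e | tail e == v] (out_lt v) }.

Variable F : framing.

Definition passes (P : seq G) (v : 'I_n.+1) : bool :=
  has (fun e => (tail e == v) || (head e == v)) P.

(* For a path P through v these are the subpaths Pv and vP, since vertices
   increase along P. *)
Definition upto (P : seq G) (v : 'I_n.+1) : seq G :=
  [seq e <- P | (head e <= v)%N].
Definition from (P : seq G) (v : 'I_n.+1) : seq G :=
  [seq e <- P | (v <= tail e)%N].

(* The common part s is maximal because a and b, being strictly comparable, are
   distinct; the vertex w (resp. w') is head a (resp. tail a). *)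
Definition ltI (p q : seq G) : Prop :=
  exists p' q' s a b, [/\ p = p' ++ a :: s, q = q' ++ b :: s,
    head a = head b & in_lt F (head a) a b].
Definition ltO (p q : seq G) : Prop :=
  exists s a b p' q', [/\ p = s ++ a :: p', q = s ++ b :: q',
    tail a = tail b & out_lt F (tail a) a b].

Definition incoherent_at (v : 'I_n.+1) (P Q : route G) : Prop :=
  (ltI (upto P v) (upto Q v) /\ ltO (from Q v) (from P v)) \/
  (ltI (upto Q v) (upto P v) /\ ltO (from P v) (from Q v)).

Definition coherent (P Q : route G) : Prop :=
  forall v, v != ord0 -> v != ord_max -> passes P v -> passes Q v ->
    ~ incoherent_at v P Q.

Definition clique (C : {set route G}) : Prop :=
  forall P Q, P \in C -> Q \in C -> coherent P Q.

Definition maximal_clique (C : {set route G}) : Prop :=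
  clique C /\ forall C' : {set route G}, clique C' -> C \subset C' -> C' = C.

(* The j such that e = e_{i,j} with i = tail e: framings order edges from top to
   bottom, so this counts the edges leaving tail e below e. *)
Definition level (e : G) : nat :=
  #|[set f | (tail f == tail e) && out_lt F (tail e) e f]%SET|.

Definition index_pred : pred G :=
  fun e => (tail e != ord0) && (0 < level e)%N.

(* The index set I, a pair (i,j) being represented by the edge e_{i,j}. *)
Definition framed_index : finType := {e : G | index_pred e}.

End Framing.

Section FramedTriangulation.
Context (R : realType) (n : nat) (G : flow_graph n) (F : framing G).

Definition conv_hull (I : finType) (V : lmodType R) (pt : I -> V)
    (S : {set I}) : set V :=
  [set v | exists a : I -> R, [/\ forall i, 0 <= a i, \sum_(i in S) a i = 1
    & v = \sum_(i in S) a i *: pt i]].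

Definition indicator (P : route G) : {ffun G -> R^o} :=
  [ffun e => (e \in (P : seq G))%:R].

Definition framed_triangulation : set (set {ffun G -> R^o}) :=
  [set B | exists C S : {set route G}, [/\ maximal_clique F C, S \subset C,
    S != finset.set0 & B = conv_hull indicator S]].

Definition lifted (h : route G -> R) (P : route G) :
    ({ffun G -> R^o} * R^o)%type := (indicator P, h P).

Definition lifted_polytope (h : route G -> R) :=
  conv_hull (lifted h) [set: route G]%SET.

Definition functional (psi : G -> R) (c : R)
    (q : ({ffun G -> R^o} * R^o)%type) : R :=
  \sum_e psi e * q.1 e + c * q.2.

Definition maximal_face (A : set ({ffun G -> R^o} * R^o)%type)
    (psi : G -> R) (c : R) : set ({ffun G -> R^o} * R^o)%type :=
  [set q | A q /\ forall q', A q' -> functional psi c q' <= functional psi c q].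

Definition regular_subdivision (h : route G -> R) :
    set (set {ffun G -> R^o}) :=
  [set B | exists psi c, 0 < c /\
    B = fst @` maximal_face (lifted_polytope h) psi c].

Definition admissible (h : route G -> R) : Prop :=
  regular_subdivision h = framed_triangulation.

End FramedTriangulation.

Section Tropical.
Context (R : realType) (n : nat) (G : flow_graph n) (F : framing G).
Variable h : route G -> R.

(* Routes of G_i are the routes of G starting with e_{0,i} without this edge.
   The term of T_i indexed by such a route is indexed here by P = e_{0,i} R;
   e_{0,i} has no coordinate in I. *)
Definition tropical_term (P : route G) (x : framed_index F -> R) : R :=
  - h P + \sum_(i : framed_index F) (val i \in (P : seq G))%:R * x i.

(* P attains the minimum in the tropical polynomial T_i of its source edge. *)
Definition attains (P : route G) (x : framed_index F -> R) : Prop :=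
  forall Q : route G, ohead Q = ohead P ->
    tropical_term P x <= tropical_term Q x.

(* The cell of the common refinement having y in its relative interior. *)
Definition tropical_cell (y : framed_index F -> R) :
    set (framed_index F -> R) :=
  [set z | forall P, attains P y -> attains P z].

Definition bounded_cell (A : set (framed_index F -> R)) : Prop :=
  exists M : R, forall z, A z -> forall i, `|z i| <= M.

Definition framingtope : set (set (framed_index F -> R)) :=
  [set A | exists2 y, A = tropical_cell y & bounded_cell A].

Definition framingtope_vertex_of (C : {set route G}) (x : framed_index F -> R) :
    Prop :=
  framingtope [set x] /\ forall P, P \in C -> attains P x.

End Tropical.

(* Edges are drawn as x-monotone curves, i.e. graphs of continuous functions. *)
Record embedding (R : realType) n (G : flow_graph n) := Embedding {
  vx : 'I_n.+1 -> R;
  vy : 'I_n.+1 -> R;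
  curve : G -> R -> R;
  vx_incr : forall u v : 'I_n.+1, (u < v)%N -> vx u < vx v;
  curve_continuous : forall e,
    {within `[vx (tail e), vx (head e)], continuous (curve e)};
  curve_tail : forall e, curve e (vx (tail e)) = vy (tail e);
  curve_head : forall e, curve e (vx (head e)) = vy (head e);
  curve_vertex : forall e v, vx (tail e) < vx v < vx (head e) ->
    curve e (vx v) != vy v;
  curve_crossing_free : forall e f t, e != f ->
    vx (tail e) < t < vx (head e) -> vx (tail f) <= t <= vx (head f) ->
    curve e t != curve f t }.

Section PlaneFramedGraph.
Context (R : realType) (n : nat) (G : flow_graph n).
Variables (D : embedding R G) (F : framing G).

Definition in_span (e : G) (t : R) : bool :=
  vx D (tail e) <= t <= vx D (head e).

Definition runs_above (e f : G) : Prop :=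
  forall t, vx D (tail e) < t < vx D (head e) ->
    vx D (tail f) < t < vx D (head f) -> curve D f t < curve D e t.

Definition induced_framing : Prop :=
  (forall e f, head e = head f -> in_lt F (head e) e f <-> runs_above e f) /\
  (forall e f, tail e = tail f -> out_lt F (tail e) e f <-> runs_above e f).

Definition drawing : set (R * R) :=
  [set q | (exists v, q = (vx D v, vy D v)) \/
           exists2 e, in_span e q.1 & q.2 = curve D e q.1].

Definition face (B : set (R * R)) : Prop :=
  exists2 q, (~` drawing) q & B = connected_component (~` drawing) q.

Definition between (U L : seq G) : set (R * R) :=
  [set q | exists e f, [/\ e \in U, f \in L, in_span e q.1, in_span f q.1
    & curve D f q.1 < q.2 < curve D e q.1]].

(* The bubble with upper boundary path U and lower boundary path L.  Such a
   face is bounded, as it lies between two curves over a compact interval. *)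
Definition bubble (U L : seq G) : Prop :=
  [/\ exists u w : 'I_n.+1, [/\ (u < w)%N, is_path u U w, is_path u L w
        & forall e f t, e \in U -> f \in L -> vx D u < t < vx D w ->
            in_span e t -> in_span f t -> curve D f t < curve D e t]
    & face (between U L)].

(* Bubbles are indexed by the first edge of their upper boundary path. *)
Definition bubble_at (e : G) (U L : seq G) : Prop :=
  bubble U L /\ ohead U = Some e.

Definition share_edge_below (ok : pred G) (p q : G) : Prop :=
  exists Up Lp Uq Lq g, [/\ bubble_at p Up Lp, bubble_at q Uq Lq,
    g \in Up, g \in Lq & ok g].

Definition bubble_le (p q : G) : bool :=
  connect [rel p' q' | `[< share_edge_below predT p' q' >]] p q.

(* Edges of level 0 are the bottommost ones. *)
Definition reaches_down (p q : G) : bool :=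
  connect [rel p' q' |
    `[< share_edge_below [pred g | (0 < level F g)%N] q' p' >]] p q.

Definition Dbar (p : G) : {set G} :=
  [set q | [&& (0 < level F q)%N, bubble_le q p & reaches_down p q]]%SET.

Definition order_ideal (P : route G) : {set G} :=
  [set p | `[< exists U L, bubble_at p U L /\
     forall q f, between U L q -> f \in (P : seq G) -> in_span f q.1 ->
       q.2 < curve D f q.1 >]]%SET.

(* p comes strictly before q in the linear extension given by the chain of order
   ideals of C. *)
Definition precedes (C : {set route G}) (p q : G) : bool :=
  [exists P in C, (p \in order_ideal P) && (q \notin order_ideal P)].

Definition Rup (C : {set route G}) (p : G) : option (route G) :=
  [pick P in C | order_ideal P ==
     p |: [set q | precedes C q p]%SET].

Definition Rdown (C : {set route G}) (p : G) : option (route G) :=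
  if Rup C p is Some P then
    [pick Q in C | order_ideal Q == (order_ideal P :\ p)%SET]
  else None.

End PlaneFramedGraph.

(* Main.v *)
Require Import Defs.
From mathcomp Require Import all_boot all_order all_algebra.
From mathcomp Require Import all_classical all_reals all_analysis.
From mathcomp Require Import zify lra.
Import Defs.

(** Fix a bubble with first upper edge [k], where [k] does not leave the source,
    and let [P] be the first route of the maximal clique which has this bubble
    below it, [Q] the route just before.  They differ only along the bubble:
    [P] contains its upper boundary and [Q] its lower one.  Both start with the
    same source edge, so both attain the same minimum at [x], and the difference
    [h P - h Q] is the sum of the coordinates along the upper boundary minus the
    sum along the lower one.  Edges of level 0 have no coordinate.  On the upper
    boundary all edges except [k] are bottommost, hence
    [x k = (h P - h Q) + sum of x g], where [g] runs over the edges of the lower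
    boundary which are not bottommost ([coordinate_step]).  Such a [g] is the
    first upper edge of the next bubble reached by crossing it downwards.  Since
    an edge lies on the lower boundary of at most one bubble, these descents form
    a forest, and unfolding the recursion collects every bubble of [Dbar] exactly
    once ([sum_descendants], [coordinate_sum]).

    The geometry enters through one observation: by the intermediate value
    theorem, two edges keep their vertical order as long as both continue, so
    two paths can only cross at a common vertex ([consecutive_lt]).  All
    comparisons are therefore made over the finitely many gaps between
    consecutive vertices.  The pair of paths which follow bottommost edges after
    [k] and topmost edges after the edge just below [k] encloses no edge
    ([lens_exists]); the region between them is a strip between two continuous
    functions, connected, open, and relatively closed in the complement of the
    drawing, hence a face ([lens_bubble]).  As bubbles with a common point are
    the same face, they have the same boundary paths ([bubble_inj]), which makes
    bubbles and lenses interchangeable.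

    Coherent routes are those which do not cross ([coherentP]), so a maximal
    clique is a maximal chain of routes ordered from bottom to top.  Between two
    comparable routes there is always a bubble which can be added to the lower
    one ([bubble_between]), and by maximality the consecutive routes [Q] and [P]
    differ by exactly one bubble ([maximal_clique_flip]). *)

Set Implicit Arguments.
Unset Strict Implicit.
Unset Printing Implicit Defensive.

Import Order.TTheory GRing.Theory Num.Theory.
Import numFieldNormedType.Exports.

Local Open Scope classical_set_scope.
Local Open Scope ring_scope.

(** * Paths and the gaps between consecutive vertices *)

Section Paths.
Context (n : nat) (G : flow_graph n).
Implicit Types (e f g : G) (u v w : 'I_n.+1) (p q : seq G) (i : nat).

(** Heights are compared over the gaps, the open strips between the abscissae
    of the consecutive vertices [i] and [i + 1]: every route has exactly one edge
    there, and no two curves meet. *)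
Definition alive e i : bool := (tail e <= i < head e)%N.

Lemma alive_tail e : alive e (tail e).
Proof. by rewrite /alive leqnn tail_lt_head. Qed.

Lemma path_end_le u p w : is_path u p w -> (u <= w)%N.
Proof.
elim: p u => [|e p IHp] u /=; first by move/eqP->.
case/andP=> /eqP <- /IHp; exact/leq_trans/ltnW/tail_lt_head.
Qed.

Lemma path_mem_bounds u p w e :
  is_path u p w -> e \in p -> (u <= tail e)%N /\ (head e <= w)%N.
Proof.
elim: p u => // f p IHp u /= /andP[/eqP <- pfw].
rewrite inE => /orP[/eqP-> | ep]; first by rewrite leqnn (path_end_le pfw).
have [le_f le_w] := IHp _ pfw ep; split=> //.
exact: leq_trans (ltnW (tail_lt_head f)) le_f.
Qed.

Lemma path_cat u p v q w :
  is_path u p v -> is_path v q w -> is_path u (p ++ q) w.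
Proof.
elim: p u => [|e p IHp] u /=; first by move/eqP->.
by case/andP=> -> /IHp IH /IH.
Qed.

Lemma path_split u p q w : is_path u (p ++ q) w ->
  exists2 v, is_path u p v & is_path v q w.
Proof.
elim: p u => [|e p IHp] u /=; first by exists u.
by case/andP=> -> /IHp.
Qed.

Lemma path_alive u p w i : is_path u p w -> (u <= i < w)%N ->
  exists2 e, e \in p & alive e i.
Proof.
elim: p u => [|e p IHp] u /=; first by move/eqP->; lia.
case/andP=> /eqP ue pw /andP[ui iw]; have [ei | ie] := leqP (head e) i.
  have [|f fp fi] := IHp _ pw; first by rewrite ei.
  by exists f; rewrite // inE fp orbT.
by exists e; rewrite ?inE ?eqxx // /alive ue ui.
Qed.

Lemma path_alive_inj u p w i e f : is_path u p w ->
  e \in p -> f \in p -> alive e i -> alive f i -> e = f.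
Proof.
elim: p u => // g p IHp u /= /andP[/eqP _ pw]; rewrite !inE.
move=> /orP[/eqP-> | ep] /orP[/eqP-> | fp] //.
- move=> /andP[_ ig] /andP[fi _].
  by have [gf _] := path_mem_bounds pw fp; lia.
- move=> /andP[ei _] /andP[_ ig].
  by have [ge _] := path_mem_bounds pw ep; lia.
exact: IHp pw ep fp.
Qed.

Lemma path_range u p w e i : is_path u p w -> e \in p -> alive e i ->
  (u <= i < w)%N.
Proof. by move=> pp ep /andP[]; have [] := path_mem_bounds pp ep; lia. Qed.

(** What a path can do when it passes from a gap to the next one. *)
Definition consecutive i e f :=
  e = f \/ head e = i.+1 :> nat /\ tail f = i.+1 :> nat.

Lemma path_consecutive u p w i e f : is_path u p w ->
  e \in p -> f \in p -> alive e i -> alive f i.+1 -> consecutive i e f.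
Proof.
move=> pp ep fp ei fi1; have [he | he] := leqP (head e) i.+1.
  have eh: head e = i.+1 :> nat by apply/eqP; rewrite eqn_leq he; case/andP: ei.
  have [ft | ft] := leqP (tail f) i; last first.
    by right; split=> //; case/andP: fi1; lia.
  have fi: alive f i by rewrite /alive ft; case/andP: fi1; lia.
  by left; apply: path_alive_inj pp ep fp ei fi.
left; apply: path_alive_inj pp ep fp _ fi1; case/andP: ei; rewrite /alive; lia.
Qed.

Lemma path_prefix u p w q z : is_path u p w -> is_path u q z ->
  {subset q <= p} -> exists2 B, p = q ++ B & is_path z B w.
Proof.
elim: q u p => [|e q IHq] u [|f p] //=.
- by move=> uw /eqP <- _; exists [::].
- by move=> pp /eqP <- _; exists (f :: p).
- by move=> _ _ /(_ e); rewrite inE eqxx => /(_ isT).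
move=> /andP[/eqP uf pp] /andP[/eqP ue qq] qp.
have ef: e = f.
  apply: (@path_alive_inj u (f :: p) w u); rewrite /= ?uf ?eqxx //.
  - by apply: qp; rewrite inE eqxx.
  - by rewrite inE eqxx.
  - by rewrite -ue alive_tail.
  - by rewrite -uf alive_tail.
subst f; have [|B -> Bw] := IHq _ _ pp qq; last by exists B.
move=> x xq; have := qp x; rewrite !inE xq orbT => /(_ isT) /orP[/eqP xe|//].
by have [] := path_mem_bounds qq xq; have := tail_lt_head e; rewrite xe; lia.
Qed.

Lemma path_sub_eq u p q w : is_path u p w -> is_path u q w ->
  {subset q <= p} -> p = q.
Proof.
move=> pp qq /(path_prefix pp qq)[[|e B] ->]; first by rewrite cats0.
by case/andP=> /eqP <- /path_end_le; have := tail_lt_head e; lia.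
Qed.

Lemma path_uniq u p w : is_path u p w -> uniq p.
Proof.
elim: p u => //= e p IHp u /andP[_ pp]; rewrite (IHp _ pp) andbT.
apply/negP=> /(path_mem_bounds pp)[+ _]; have := tail_lt_head e; lia.
Qed.

Lemma path_cut_tail u p w e : is_path u p w -> e \in p ->
  exists p1 p2, [/\ p = p1 ++ e :: p2, is_path u p1 (tail e)
    & is_path (head e) p2 w].
Proof.
move=> pp /path.splitPr ep; case: ep pp => p1 p2 /path_split[v] p1v /=.
by case/andP=> /eqP ve p2w; exists p1, p2; rewrite ve.
Qed.

Lemma path_subpath u p w v q z : is_path u p w -> is_path v q z ->
  (v < z)%N -> {subset q <= p} ->
  exists A B, [/\ p = A ++ q ++ B, is_path u A v & is_path z B w].
Proof.
move=> pp; case: q => [|e q] qz vz qp; first by move/eqP: qz vz => ->; lia.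
have [|A [B [pE pA pB]]] := path_cut_tail pp (e := e).
  by apply: qp; rewrite inE eqxx.
have ev: tail e = v by case/andP: qz => /eqP.
have eBw: is_path v (e :: B) w by rewrite /= ev eqxx.
have [|C eB Cw] := path_prefix eBw qz; last by exists A, C; rewrite pE eB -ev.
move=> x xq; have := qp _ xq; rewrite pE mem_cat => /orP[xA|//].
have [_ xe] := path_mem_bounds pA xA; have [vx _] := path_mem_bounds qz xq.
by have := tail_lt_head x; rewrite ev in xe; lia.
Qed.

(** Only the source has no entering edge and only the sink has no leaving one,
    so a path can be prolonged backwards to the source, and forwards to the
    sink by means of any prescribed choice of leaving edges. *)
Lemma path_from_source v : exists p : seq G, is_path ord0 p v.
Proof.
have [k] := ubnP v; elim: k v => // k IHk v vk.
have [-> | v0] := eqVneq v ord0; first by exists [::] => /=.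
have [e ev]: exists e : G, head e = v.
  apply: contrapT => /forallNP noe; move/eqP: v0; apply.
  by apply/(unique_source G) => e; apply/eqP.
have [|p pe] := IHk (tail e); first by have := tail_lt_head e; rewrite ev; lia.
by exists (rcons p e); rewrite -cats1; apply: path_cat pe _; rewrite /= ev !eqxx.
Qed.

Lemma tail_exists v : v != ord_max -> exists e : G, tail e = v.
Proof.
move=> vn; apply: contrapT => /forallNP noe; move/eqP: vn; apply.
by apply/(unique_sink G) => e; apply/eqP.
Qed.

Lemma path_to_sink (sel : pred G) v :
  (forall z, z != ord_max -> exists2 e, tail e = z & sel e) ->
  exists2 p : seq G, is_path v p ord_max & all sel p.
Proof.
move=> selP; have [k] := ubnP (n - v); elim: k v => // k IHk v vk.
have [-> | vn] := eqVneq v ord_max; first by exists [::] => /=.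
have [e ev se] := selP v vn.
have [|p pe ps] := IHk (head e).
  by have := tail_lt_head e; have := ltn_ord (head e); rewrite ev; lia.
by exists (e :: p); rewrite /= ?ev ?eqxx ?pe // se.
Qed.

Lemma size_path u p w : is_path u p w -> (size p <= n)%N.
Proof.
suff: is_path u p w -> (u + size p <= n)%N by move=> H /H; lia.
elim: p u => [|e p IHp] u /=; first by have := ltn_ord u; lia.
by case/andP=> /eqP <- /IHp; have := tail_lt_head e; lia.
Qed.

Lemma routeP (P : route G) : is_path ord0 P ord_max.
Proof. exact: route_path. Qed.

Lemma route_of_path p : is_path ord0 p ord_max ->
  exists P : route G, P = p :> seq G.
Proof.
move=> pp; have sp: (size p <= n)%N := size_path pp.
by exists (@Route n G (Bseq sp) pp).
Qed.

Lemma route_inj (P Q : route G) : P = Q :> seq G -> P = Q.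
Proof. by move=> PQ; apply/val_inj/val_inj. Qed.

Lemma route_through e : exists P : route G, e \in (P : seq G).
Proof.
have [p pe] := path_from_source (tail e).
have [|q eq _] := @path_to_sink predT (head e).
  by move=> z /tail_exists[f]; exists f.
have [|P PE] := route_of_path (p := p ++ e :: q).
  by apply: path_cat pe _; rewrite /= eqxx.
by exists P; rewrite PE mem_cat inE eqxx orbT.
Qed.

Lemma route_alive (P : route G) i : (i < n)%N ->
  exists2 e, e \in (P : seq G) & alive e i.
Proof. by move=> lin; apply: path_alive (routeP P) _. Qed.

Lemma alive_lt e i : alive e i -> (i < n)%N.
Proof. by rewrite /alive; have := ltn_ord (head e); lia. Qed.

End Paths.

(** * Edges over the gaps of a drawing *)

Lemma constant_sign (R : realType) (g : R -> R) (t1 t2 : R) : t1 <= t2 ->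
  {within `[t1, t2], continuous g} ->
  (forall s, t1 <= s <= t2 -> g s != 0) -> (0 < g t1) = (0 < g t2).
Proof.
move=> t12 gc gn0.
have nz : ~ (Num.min (g t1) (g t2) <= 0 <= Num.max (g t1) (g t2)).
  by move=> /(IVT t12 gc)[s]; rewrite in_itv /= => /gn0/eqP.
have n1 : g t1 != 0 by apply: gn0; rewrite lexx.
have n2 : g t2 != 0 by apply: gn0; rewrite lexx t12.
apply/idP/idP => g0; rewrite lt_neqAle eq_sym ?n1 ?n2 /= leNgt; apply/negP => g1;
  by apply: nz; rewrite ge_min le_max (ltW g0) (ltW g1) ?orbT.
Qed.

Section Gaps.
Context (R : realType) (n : nat) (G : flow_graph n) (D : embedding R G).
Implicit Types (e f a b : G) (i : nat) (t : R).

Definition xv i : R := vx D (inord i).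
Definition mid i : R := (xv i + xv i.+1) / 2.
Definition cv e i : R := curve D e (mid i).

Lemma vxE v : vx D v = xv v.
Proof. by rewrite /xv inord_val. Qed.

Lemma xv_lt i j : (i < j <= n)%N -> xv i < xv j.
Proof. by move=> ij; apply: vx_incr; rewrite !inordK; lia. Qed.

Lemma xv_le i j : (i <= j <= n)%N -> xv i <= xv j.
Proof.
move=> /andP[]; rewrite leq_eqVlt => /orP[/eqP -> //| ij jn].
by apply/ltW/xv_lt; rewrite ij.
Qed.

Lemma mid_gap i : (i < n)%N -> xv i < mid i < xv i.+1.
Proof. by move=> lin; have := @xv_lt i i.+1; rewrite ltnSn lin /mid; lra. Qed.

Lemma alive_gap e i : alive e i ->
  vx D (tail e) <= xv i /\ xv i.+1 <= vx D (head e).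
Proof.
move=> /andP[ei ie]; rewrite !vxE; have := ltn_ord (head e).
by split; apply: xv_le; lia.
Qed.

Lemma alive_span e i t : alive e i -> xv i <= t <= xv i.+1 -> in_span D e t.
Proof. by move=> /alive_gap[]; rewrite /in_span; lra. Qed.

Lemma alive_mid e i : alive e i -> vx D (tail e) < mid i < vx D (head e).
Proof. by move=> ei; have [] := alive_gap ei; have := mid_gap (alive_lt ei); lra. Qed.

Lemma mid_alive e i : (i < n)%N -> in_span D e (mid i) -> alive e i.
Proof.
move=> lin /andP[te he]; have /andP[m1 m2] := mid_gap lin; apply/andP; split.
  rewrite leqNgt; apply/negP => ie; have := ltn_ord (tail e).
  have /xv_le : (i.+1 <= tail e <= n)%N by have := ltn_ord (tail e); lia.
  by rewrite -vxE; lra.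
rewrite ltnNge; apply/negP => ie.
have /xv_le : (head e <= i <= n)%N by lia.
by rewrite -vxE; lra.
Qed.

Lemma span_gap e t : in_span D e t -> exists2 i, alive e i & xv i <= t <= xv i.+1.
Proof.
move=> /andP[te the].
pose Q (k : nat) := (k < head e)%N && (xv k <= t).
have exQ : exists k, Q k by exists (tail e); rewrite /Q tail_lt_head -vxE.
have ubQ k : Q k -> (k <= n)%N.
  by case/andP=> kh _; have := ltn_ord (head e); lia.
case: (ex_maxnP exQ ubQ) => i /andP[ih it] imax.
exists i.
  rewrite /alive ih andbT; apply: imax.
  by rewrite /Q tail_lt_head -vxE.
rewrite it /=; have [he | he] := leqP (head e) i.+1.
  suff <- : head e = i.+1 :> nat by rewrite -vxE.
  by apply/eqP; rewrite eqn_leq he.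
rewrite leNgt; apply/negP => ti.
by have := imax i.+1; rewrite /Q he (ltW ti) => /(_ isT); rewrite ltnn.
Qed.

(** A curve is only continuous on the span of its edge.  Prolonged by constants
    it is continuous on the whole line, so that curves of different edges can be
    subtracted and added. *)
Definition ext e t : R :=
  curve D e (Num.max (vx D (tail e)) (Num.min t (vx D (head e)))).

Lemma ext_span e t : in_span D e t -> ext e t = curve D e t.
Proof. by case/andP=> te the; rewrite /ext min_l // max_r. Qed.

Lemma span_le e : vx D (tail e) <= vx D (head e).
Proof. exact/ltW/vx_incr/tail_lt_head. Qed.

Lemma ext_tail e t : t <= vx D (tail e) -> ext e t = vy D (tail e).
Proof.
move=> te; rewrite /ext min_l ?max_l ?curve_tail //.
exact: le_trans te (span_le e).
Qed.

Lemma ext_head e t : vx D (head e) <= t -> ext e t = vy D (head e).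
Proof. by move=> te; rewrite /ext min_r ?max_r ?curve_head // span_le. Qed.

Lemma ext_continuous e : continuous (ext e).
Proof.
move=> t; rewrite /ext.
pose c (s : R) := Num.max (vx D (tail e)) (Num.min s (vx D (head e))).
have cA s : `[vx D (tail e), vx D (head e)]%classic (c s).
  rewrite /= in_itv /= /c le_max lexx /= ge_max span_le /=.
  by rewrite ge_min lexx orbT.
have cc : continuous c.
  move=> s; apply: (@continuous_max _ _ (cst _) (fun x => Num.min x _) s).
    exact: cst_continuous.
  by apply: (@continuous_min _ _ id (cst _) s); [by move=> ? | exact: cst_continuous].
have /subspace_continuousP/(_ (c t) (cA t)) ce := @curve_continuous R n G D e.
apply: (@cvg_comp _ _ _ c (curve D e) _ (within _ (nbhs (c t))) _ _ ce).
move=> A nA; exact: filterS (fun s (As : _ -> A (c s)) => As (cA s)) (cc t _ nA).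
Qed.

(** By the intermediate value theorem, an exchange of the vertical order would
    produce a point common to both curves in the interior of the span of [e]. *)
Lemma edge_side e f t1 t2 : e != f ->
  vx D (tail e) < t1 < vx D (head e) -> vx D (tail e) < t2 < vx D (head e) ->
  in_span D f t1 -> in_span D f t2 ->
  (curve D e t1 < curve D f t1) = (curve D e t2 < curve D f t2).
Proof.
move=> ef; wlog t12 : t1 t2 / t1 <= t2 => [W | ] e1 e2 f1 f2.
  by have [?|?] := lerP t1 t2; [apply: W | apply/esym/W => //; apply/ltW].
pose g s := ext f s - ext e s.
have span_e s : vx D (tail e) < s < vx D (head e) -> in_span D e s.
  by rewrite /in_span; lra.
have gc : {within `[t1, t2], continuous g}.
  apply: continuous_subspaceT => s.
  by apply: cvgB; exact: ext_continuous.
have gE s : t1 <= s <= t2 -> g s = curve D f s - curve D e s.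
  move=> ss; rewrite /g !ext_span //; first by apply: span_e; lra.
  by move: f1 f2; rewrite /in_span; lra.
have gn0 s : t1 <= s <= t2 -> g s != 0.
  move=> ss; rewrite gE // subr_eq0 eq_sym; apply: curve_crossing_free => //.
    by lra.
  by move: f1 f2; rewrite /in_span; lra.
have gpos : (0 < g t1) = (0 < g t2) by exact: constant_sign.
by rewrite -subr_gt0 -gE ?gpos ?gE ?subr_gt0 // !lexx ?t12.
Qed.

Lemma edge_side_gt e f t1 t2 : e != f ->
  vx D (tail e) < t1 < vx D (head e) -> vx D (tail e) < t2 < vx D (head e) ->
  in_span D f t1 -> in_span D f t2 ->
  (curve D f t1 < curve D e t1) = (curve D f t2 < curve D e t2).
Proof.
move=> ef e1 e2 f1 f2.
have neq t : vx D (tail e) < t < vx D (head e) -> in_span D f t ->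
    (curve D f t < curve D e t) = ~~ (curve D e t < curve D f t).
  by move=> et ft; rewrite -leNgt le_eqVlt eq_sym (negPf (curve_crossing_free ef et ft)).
by rewrite !neq // (edge_side ef e1 e2).
Qed.

Lemma cv_inj e f i : alive e i -> alive f i -> cv e i = cv f i -> e = f.
Proof.
move=> ei fi; apply: contra_eq => ef; apply: curve_crossing_free => //.
  exact: alive_mid.
by have := alive_mid fi; lra.
Qed.

Lemma xv_head e i : head e = i :> nat -> vx D (head e) = xv i.
Proof. by rewrite vxE => ->. Qed.

Lemma xv_tail e i : tail e = i :> nat -> vx D (tail e) = xv i.
Proof. by rewrite vxE => ->. Qed.

(** The difference of the two curves keeps its sign up to the ends of the gap,
    where it can only vanish. *)
Lemma gap_le e f i t : alive e i -> alive f i -> xv i <= t <= xv i.+1 ->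
  cv e i <= cv f i -> curve D e t <= curve D f t.
Proof.
move=> ei fi ti; rewrite le_eqVlt => /predU1P[/(cv_inj ei fi) -> // | lt_ef].
have ef : e != f by apply: contraTneq lt_ef => ->; rewrite ltxx.
have em := alive_mid ei; have fm := alive_mid fi.
have et := alive_span ei ti; have ft := alive_span fi ti.
have [et' | et'] := boolP (vx D (tail e) < t < vx D (head e)).
  rewrite ltW // -(edge_side ef em et') //; by rewrite /in_span; lra.
have [ft' | ft'] := boolP (vx D (tail f) < t < vx D (head f)).
  rewrite ltW // -(edge_side_gt _ fm ft') // 1?eq_sym //; by rewrite /in_span; lra.
move: et ft et' ft'; rewrite /in_span => /andP[e1 e2] /andP[f1 f2] e' f'.
have [ae1 ae2] := alive_gap ei; have [af1 af2] := alive_gap fi.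
have ii : xv i < xv i.+1 by have := mid_gap (alive_lt ei); lra.
have vinj (u v : 'I_n.+1) : vx D u = vx D v -> u = v.
  move=> uv; apply/eqP; rewrite -val_eqE eqn_leq; apply/andP; split.
    by rewrite leqNgt; apply/negP => /(vx_incr D); rewrite uv ltxx.
  by rewrite leqNgt; apply/negP => /(vx_incr D); rewrite uv ltxx.
have [te | te] := eqVneq (vx D (tail e)) t.
  have tf : vx D (tail f) = t by move: f'; lra.
  have eqt := vinj _ _ (etrans te (esym tf)).
  by rewrite -{1}te -tf !curve_tail eqt.
have he : vx D (head e) = t by move: e' te; lra.
have hf : vx D (head f) = t by move: f'; lra.
have eqh := vinj _ _ (etrans he (esym hf)).
by rewrite -{1}he -hf !curve_head eqh.
Qed.

(** Paths can only cross at a vertex through which both of them pass: an edge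
    which continues over a vertex keeps this vertex, and with it the edges which
    enter or leave there, on one side. *)
Lemma consecutive_lt i a a' b b' :
  alive a i -> alive b i -> alive a' i.+1 -> alive b' i.+1 ->
  consecutive i a a' -> consecutive i b b' ->
  ~ (tail a' = i.+1 :> nat /\ tail b' = i.+1 :> nat) ->
  cv a i < cv b i -> cv a' i.+1 < cv b' i.+1.
Proof.
move=> ai bi ai' bi' ca cb nab ltab.
have ne (c d : G) : cv c i != cv d i -> c != d by apply: contraNneq => ->.
have m_span (c : G) j : alive c j -> in_span D c (mid j).
  by move/alive_mid; rewrite /in_span; lra.
have v_open (c : G) : alive c i -> alive c i.+1 -> vx D (tail c) < xv i.+1 < vx D (head c).
  move=> ci ci1; have [c1 _] := alive_gap ci; have [_ c2] := alive_gap ci1.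
  by have := mid_gap (alive_lt ci1); have := mid_gap (ltnW (alive_lt ci1)); lra.
have v_head (c : G) : head c = i.+1 :> nat ->
    in_span D c (xv i.+1) /\ curve D c (xv i.+1) = vy D (inord i.+1).
  move=> hc; rewrite -(xv_head hc) curve_head /in_span span_le lexx; split=> //.
  by congr vy; apply/val_inj; rewrite /= -hc inord_val.
have v_tail (c : G) : tail c = i.+1 :> nat ->
    in_span D c (xv i.+1) /\ curve D c (xv i.+1) = vy D (inord i.+1).
  move=> hc; rewrite -(xv_tail hc) curve_tail /in_span span_le lexx; split=> //.
  by congr vy; apply/val_inj; rewrite /= -hc inord_val.
have ab : a != b by apply: ne; rewrite lt_eqF.
case: ca cb => [aa|[ha ta]] [bb|[hb tb]].
- by subst a' b'; rewrite /cv -(edge_side ab (alive_mid ai)) ?alive_mid ?m_span.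
- subst a'; have [sb eb] := v_head b hb; have [sb' eb'] := v_tail b' tb.
  have ab' : a != b'.
    by apply: contraTneq ai => ->; rewrite /alive tb ltnn.
  have vo := v_open a ai ai'.
  rewrite /cv -(edge_side ab' vo (alive_mid ai')) ?m_span // eb' -eb.
  by rewrite -(edge_side ab (alive_mid ai) vo) ?m_span.
- subst b'; have [sb eb] := v_head a ha; have [sb' eb'] := v_tail a' ta.
  have ab' : b != a'.
    by apply: contraTneq bi => ->; rewrite /alive ta ltnn.
  have vo := v_open b bi bi'; rewrite eq_sym in ab.
  rewrite /cv -(edge_side_gt ab' vo (alive_mid bi')) ?m_span // eb' -eb.
  by rewrite -(edge_side_gt ab (alive_mid bi) vo) ?m_span.
by case: nab.
Qed.

End Gaps.

(** * Extreme edges and lenses *)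

Section Order.
Context (R : realType) (n : nat) (G : flow_graph n) (D : embedding R G).
Context (F : framing G) (hF : induced_framing D F).
Implicit Types (e f a b k : G) (u v w : 'I_n.+1) (p q : seq G) (i : nat).
Local Notation cv := (cv D).

Lemma consecutive_le i a a' b b' :
  alive a i -> alive b i -> alive a' i.+1 -> alive b' i.+1 ->
  consecutive i a a' -> consecutive i b b' ->
  ~ (tail a' = i.+1 :> nat /\ tail b' = i.+1 :> nat) ->
  cv a i <= cv b i -> cv a' i.+1 <= cv b' i.+1.
Proof.
move=> ai bi ai' bi' ca cb nab; rewrite le_eqVlt => /predU1P[|lt_ab]; last first.
  exact/ltW/(consecutive_lt ai bi).
move/(cv_inj ai bi) => ab; subst b.
case: ca cb => [aa | [ha ta]] [ab | [hb tb]]; last by case: nab.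
- by rewrite -aa -ab.
- by move: ai'; rewrite -aa /alive hb ltnn andbF.
by move: bi'; rewrite -ab /alive ha ltnn andbF.
Qed.

Lemma runs_aboveP e f i : alive e i -> alive f i ->
  runs_above D e f <-> cv f i < cv e i.
Proof.
move=> ei fi; have em := alive_mid D ei; have fm := alive_mid D fi.
split=> [|lt_fe t te tf]; first by apply.
have ef : e != f by apply: contraTneq lt_fe => ->; rewrite ltxx.
by rewrite -(edge_side_gt ef em te) // /in_span; lra.
Qed.

Lemma out_ltP e f : tail f = tail e ->
  out_lt F (tail e) e f <-> cv f (tail e) < cv e (tail e).
Proof.
move=> fe; have fa : alive f (tail e) by rewrite -fe alive_tail.
rewrite -(runs_aboveP (alive_tail e) fa); exact: (proj2 hF).
Qed.

Lemma in_ltP e f i : head e = head f -> alive e i -> alive f i ->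
  in_lt F (head e) e f <-> cv f i < cv e i.
Proof. by move=> ef ei fi; rewrite -(runs_aboveP ei fi); apply: (proj1 hF). Qed.

Lemma level_gt0P e :
  reflect (exists2 f, tail f = tail e & cv f (tail e) < cv e (tail e))
    (0 < level F e)%N.
Proof.
rewrite /level; apply: (iffP card_gt0P) => [[f]|[f fe lt_fe]].
  by rewrite inE => /andP[/eqP fe /(out_ltP fe)]; exists f.
by exists f; rewrite inE fe eqxx; apply/out_ltP.
Qed.

(** The direction is a parameter so that bottommost and topmost edges are
    treated at once. *)
Definition dir_le (up : bool) (x y : R) := if up then x <= y else y <= x.

Definition extreme (up : bool) : pred G := fun e =>
  [forall f, (tail f == tail e) ==> dir_le up (cv e (tail e)) (cv f (tail e))].

Lemma extremeP up e f : extreme up e -> tail f = tail e ->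
  dir_le up (cv e (tail e)) (cv f (tail e)).
Proof. by move=> /forallP/(_ f)/implyP + fe; apply; rewrite fe. Qed.

Lemma low_level e : extreme true e = (level F e == 0)%N.
Proof.
apply/idP/idP => [low|]; last first.
  rewrite -leqn0 leqNgt => /level_gt0P nolow.
  apply/forallP => f; apply/implyP => /eqP fe; rewrite /= leNgt.
  by apply/negP => lt_fe; apply: nolow; exists f.
rewrite -leqn0 leqNgt; apply/level_gt0P => -[f fe].
by have /= := extremeP low fe; rewrite leNgt => /negP.
Qed.

Lemma extreme_exists up v : v != ord_max -> exists2 e, tail e = v & extreme up e.
Proof.
move=> /(@tail_exists n G)[e0 e0v].
pose s f : R := if up then cv f v else - cv f v.
have [e /eqP ev emin] := @arg_minP _ _ G e0 (fun f => tail f == v) s (introT eqP e0v).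
exists e => //; apply/forallP => f; apply/implyP => /eqP fe.
have := emin f; rewrite fe ev eqxx /s /dir_le => /(_ isT).
by case: (up) => //; rewrite lerN2.
Qed.

(** A route could only cross the path at a common vertex, and there the edge
    chosen by the path is extreme. *)
Lemma extreme_path up u e p w (P : route G) :
  is_path u (e :: p) w -> all (extreme up) p ->
  (forall b, b \in (P : seq G) -> alive b (tail e) ->
     dir_le up (cv e (tail e)) (cv b (tail e))) ->
  forall i a b, a \in e :: p -> b \in (P : seq G) -> alive a i -> alive b i ->
    dir_le up (cv a i) (cv b i).
Proof.
move=> pp pext start; have ue : tail e = u by case/andP: pp => /eqP.
have e_in : e \in e :: p by rewrite inE eqxx.
elim=> [|i IHi] a' b' a'p b'P a'i b'i.
  have a'e : a' = e.
    apply: (path_alive_inj pp a'p e_in a'i).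
    have := path_range pp a'p a'i; have := tail_lt_head e.
    by rewrite ue /alive ue; lia.
  subst a'; have te : tail e = 0%N :> nat by move: a'i; rewrite /alive; lia.
  by have := start b' b'P; rewrite te; apply.
have [ui | iu] := leqP u i; last first.
  have te : tail e = i.+1 :> nat.
    by have := path_range pp a'p a'i; rewrite ue; lia.
  have a'e : a' = e.
    by apply: path_alive_inj pp a'p e_in a'i _; rewrite -te alive_tail.
  by subst a'; have := start b' b'P; rewrite te; apply.
have iw : (i < w)%N by have := path_range pp a'p a'i; lia.
have [|a ap ai] := path_alive pp (i := i); first by rewrite ui.
have [|b bP bi] := @route_alive n G P i; first by have := alive_lt a'i; lia.
have ca := path_consecutive pp ap a'p ai a'i.
have cb := path_consecutive (routeP P) bP b'P bi b'i.
have [/andP[/eqP ta /eqP tb]|nab] :=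
    boolP ((tail a' == i.+1 :> nat) && (tail b' == i.+1 :> nat)).
  rewrite -ta; apply: extremeP; last by apply/val_inj; rewrite /= tb ta.
  move: a'p; rewrite inE => /predU1P[a'e|/(allP pext)//].
  by move: ta; rewrite a'e ue; lia.
have {nab} nab : ~ (tail a' = i.+1 :> nat /\ tail b' = i.+1 :> nat).
  by move=> [ta tb]; move: nab; rewrite ta tb !eqxx.
have := IHi a b ap bP ai bi; rewrite /dir_le; case: (up).
  exact: consecutive_le.
by apply: consecutive_le => // -[tb ta]; apply: nab.
Qed.

(** The combinatorial form of a bubble.  That the two boundary paths meet only at
    their ends is the separate condition [lens_vertex], because a comparison of
    heights over the gaps does not see the vertices. *)
Record lens u w (U L : seq G) : Prop := Lens {
  lens_lt : (u < w)%N;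
  lens_up : is_path u U w;
  lens_low : is_path u L w;
  lens_sep : forall i a b, a \in U -> b \in L -> alive a i -> alive b i ->
    cv b i < cv a i;
  lens_void : forall i a b e, a \in U -> b \in L ->
    alive a i -> alive b i -> alive e i -> ~ (cv b i < cv e i < cv a i);
  lens_vertex : forall a b, a \in U -> b \in L -> tail a = tail b ->
    tail a = u }.

Lemma path_tail_head u p w e : is_path u p w -> e \in p -> tail e != u ->
  exists2 f, f \in p & head f = tail e.
Proof.
elim: p u => // g p IHp u /= /andP[/eqP <- pp]; rewrite inE => /predU1P[->|ep].
  by rewrite eqxx.
move=> _; have [eg|eg] := eqVneq (tail e) (head g); last first.
  by have [f fp fe] := IHp _ pp ep eg; exists f; rewrite // inE fp orbT.
by exists g; rewrite ?inE ?eqxx.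
Qed.

Lemma path_cut_head u p w e : is_path u p w -> e \in p ->
  exists p1 p2, p = rcons p1 e ++ p2 /\ is_path u (rcons p1 e) (head e).
Proof.
move=> pp ep; have [p1 [p2 [-> p1p _]]] := path_cut_tail pp ep.
exists p1, p2; rewrite cat_rcons; split=> //.
by rewrite -cats1; apply: (path_cat p1p); rewrite /= !eqxx.
Qed.

(** The paths are cut at the first vertex where they meet again, which is the
    sink at the latest. *)
Lemma first_meeting u e p f q : is_path u (e :: p) ord_max ->
  is_path u (f :: q) ord_max -> exists w p' p2 q' q2,
  [/\ p = p' ++ p2, q = q' ++ q2, is_path u (e :: p') w, is_path u (f :: q') w
    & forall a b, a \in e :: p' -> b \in f :: q' -> tail a = tail b -> tail a = u].
Proof.
move=> ep fq.
pose meets w := has (fun c => head c == w) (e :: p) &&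
                has (fun c => head c == w) (f :: q).
have sink_head g (r : seq G) : is_path (head g) r ord_max ->
    has (fun c => head c == ord_max) (g :: r).
  elim: r g => [|h r IHr] g /=; first by move->.
  by case/andP=> _ /IHr /= ->; rewrite orbT.
have meets_sink : meets ord_max.
  by rewrite /meets !sink_head //; [case/andP: fq | case/andP: ep].
have [w /andP[/hasP[a ap /eqP aw] /hasP[b bq /eqP bw]] wmin] :=
  @arg_minnP _ ord_max meets (@nat_of_ord _) meets_sink.
have [p1 [p2 [pE p1p]]] := path_cut_head ep ap.
have [q1 [q2 [qE q1q]]] := path_cut_head fq bq.
rewrite aw in p1p; rewrite bw in q1q.
case pr: (rcons p1 a) pE p1p => [|e' p']; first by case: (p1) pr.
case=> <- pE p1p {e' pr}; case qr: (rcons q1 b) qE q1q => [|f' q'].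
  by case: (q1) qr.
case=> <- qE q1q {f' qr}; exists w, p', p2, q', q2; split=> // c d cp dq cd.
apply/eqP/negPn/negP => cu.
have [c' c'p c'c] := path_tail_head p1p cp cu.
have [|d' d'q d'd] := path_tail_head q1q dq; first by rewrite -cd.
have /wmin wc : meets (tail c).
  apply/andP; split; apply/hasP.
    by exists c'; rewrite ?c'c // pE -cat_cons mem_cat c'p.
  by exists d'; rewrite ?d'd ?cd // qE -cat_cons mem_cat d'q.
have [_ cw] := path_mem_bounds p1p cp.
by have := leq_trans (leq_trans (tail_lt_head c) cw) wc; rewrite ltnn.
Qed.

(** The upper boundary follows the bottommost edges after [k], the lower one the
    topmost edges after [f], up to the first vertex where they meet.  An edge
    inside would have to leave a vertex of one of the two paths on the wrong side
    of an extreme edge, or to leave the common first vertex between [f] and [k],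
    or to enter from the left through this vertex, where the region closes. *)
Lemma lens_exists f k : tail f = tail k -> cv f (tail k) < cv k (tail k) ->
  (forall e, tail e = tail k -> ~ (cv f (tail k) < cv e (tail k) < cv k (tail k))) ->
  exists w U L, [/\ lens (tail k) w (k :: U) (f :: L), all (extreme true) U
    & all (extreme false) L].
Proof.
move=> fk lt_fk adj.
have [pU pUp pUe] := path_to_sink (head k) (extreme_exists true).
have [pL pLp pLe] := path_to_sink (head f) (extreme_exists false).
have kp : is_path (tail k) (k :: pU) ord_max by rewrite /= eqxx.
have fp : is_path (tail k) (f :: pL) ord_max by rewrite /= fk eqxx.
have [w [U [U2 [L [L2 [pUE pLE Up Lp vertex]]]]]] := first_meeting kp fp.
have Ulow : all (extreme true) U by move: pUe; rewrite pUE all_cat => /andP[].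
have Lhigh : all (extreme false) L by move: pLe; rewrite pLE all_cat => /andP[].
have uw : (tail k < w)%N.
  case/andP: (Up) => _ /path_end_le; exact/leq_trans/tail_lt_head.
move=> {pU pUp pUe pL pLp pLe kp fp pUE pLE U2 L2}.
have k_in : k \in k :: U by rewrite inE eqxx.
have f_in : f \in f :: L by rewrite inE eqxx.
have f_al : alive f (tail k) by rewrite -fk alive_tail.
have nmeet i c d : (tail k <= i)%N -> c \in k :: U -> d \in f :: L ->
    ~ (tail c = i.+1 :> nat /\ tail d = i.+1 :> nat).
  move=> ki cU dL [tc td]; have cd : tail c = tail d by apply/val_inj; rewrite /= tc td.
  by move: ki; rewrite -(vertex _ _ cU dL cd) tc ltnn.
have first_k c : c \in k :: U -> alive c (tail k) -> c = k.
  by move=> cU ck; apply: (path_alive_inj Up cU k_in ck); apply: alive_tail.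
have first_f c : c \in f :: L -> alive c (tail k) -> c = f.
  by move=> cL ck; apply: (path_alive_inj Lp cL f_in ck).
(* the separation and the emptiness both propagate from one gap to the next *)
have step i c' d' : (tail k <= i)%N -> c' \in k :: U -> d' \in f :: L ->
    alive c' i.+1 -> alive d' i.+1 -> exists c d, [/\ c \in k :: U,
      d \in f :: L, alive c i, alive d i & consecutive i c c' /\ consecutive i d d'].
  move=> ki c'U d'L c'i d'i; have /andP[_ /ltnW iw] := path_range Up c'U c'i.
  have [|c cU ci] := path_alive Up (i := i); first by rewrite ki.
  have [|d dL di] := path_alive Lp (i := i); first by rewrite ki.
  exists c, d; split=> //; split; first exact: (path_consecutive Up).
  exact: (path_consecutive Lp).
have sep i c d : c \in k :: U -> d \in f :: L -> alive c i -> alive d i -> cv d i < cv c i.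
  move=> cU dL ci; have := path_range Up cU ci => /andP[ki _]; move: ci.
  rewrite -(subnKC ki); elim: (i - tail k)%N c d cU dL => [|j IHj] c d cU dL.
    rewrite addn0 => /(first_k _ cU) -> /(first_f _ dL) ->; exact: lt_fk.
  rewrite addnS => ci di; set i0 := (tail k + j)%N in ci di IHj *.
  have ki0 : (tail k <= i0)%N by rewrite leq_addr.
  have [c0 [d0 [c0U d0L c0i d0i [cc dd]]]] := step _ _ _ ki0 cU dL ci di.
  apply: (consecutive_lt d0i c0i) => //; last exact: IHj.
  by move=> [td tc]; apply: (nmeet _ _ _ ki0 cU dL).
exists w, U, L; split=> //; split=> // i c d e cU dL ci.
have := path_range Up cU ci => /andP[ki _]; move: ci.
rewrite -(subnKC ki); elim: (i - tail k)%N c d e cU dL => [|j IHj] c d e cU dL.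
  rewrite addn0 => /(first_k _ cU) -> /(first_f _ dL) -> ek /andP[lt_fe lt_ek].
  have [te|te] := eqVneq (tail e) (tail k); first by apply: (adj e); rewrite ?lt_fe.
  (* otherwise [e] would be squeezed to the vertex where the paths begin *)
  have ut : xv D (tail k) <= vx D (tail k) <= xv D (tail k).+1.
    rewrite vxE lexx /=; apply: xv_le; rewrite leqnSn /=; exact: alive_lt ek.
  have := gap_le ek (alive_tail k) ut (ltW lt_ek).
  have := gap_le f_al ek ut (ltW lt_fe); rewrite -{1}fk !curve_tail fk => le1 le2.
  suff /(curve_vertex)/eqP : vx D (tail e) < vx D (tail k) < vx D (head e).
    by apply; apply/eqP; rewrite eq_le le1 le2.
  case/andP: ek => ek1 ek2; rewrite !vx_incr // ltn_neqAle ek1 andbT.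
  exact: te.
rewrite addnS; set i0 := (tail k + j)%N in IHj * => ci di ei /andP[lt_de lt_ec].
have ki0 : (tail k <= i0)%N by rewrite leq_addr.
have [c0 [d0 [c0U d0L c0i d0i [cc dd]]]] := step _ _ _ ki0 cU dL ci di.
have squeeze e0 : alive e0 i0 -> consecutive i0 e0 e ->
    (tail e = i0.+1 :> nat -> tail c != i0.+1 :> nat /\ tail d != i0.+1 :> nat) -> False.
  move=> e0i e0e nv; apply: (IHj _ _ e0 c0U d0L c0i d0i e0i).
  apply/andP; split; rewrite ltNge; apply/negP => le0.
    suff : cv e i0.+1 <= cv d i0.+1 by rewrite leNgt lt_de.
    apply: (consecutive_le e0i d0i) => // -[/nv[_ /eqP]]; exact.
  suff : cv c i0.+1 <= cv e i0.+1 by rewrite leNgt lt_ec.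
  by apply: (consecutive_le c0i e0i) => // -[+ /nv[/eqP + _]] => tc; apply.
have [te|te] := ltnP i0 (tail e); last first.
  apply: (squeeze e); last by move=> eE; move: te; rewrite eE ltnn.
    by move/andP: ei => [_ /ltnW]; rewrite /alive te.
  by left.
have {}te : tail e = i0.+1 :> nat by apply/eqP; rewrite eqn_leq te; case/andP: ei => ->.
have nc : tail c != i0.+1 :> nat.
  apply/eqP => tc; have ce : tail e = tail c by apply/val_inj; rewrite /= te tc.
  suff /extremeP/(_ ce) : extreme true c by rewrite /dir_le tc leNgt lt_ec.
  move: cU; rewrite inE => /predU1P[ck|/(allP Ulow)//].
  by move: ki0; rewrite -ck tc ltnn.
have nd : tail d != i0.+1 :> nat.
  apply/eqP => td; have de : tail e = tail d by apply/val_inj; rewrite /= te td.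
  suff /extremeP/(_ de) : extreme false d by rewrite /dir_le td leNgt lt_de.
  move: dL; rewrite inE => /predU1P[df|/(allP Lhigh)//].
  by move: ki0; rewrite -fk -df td ltnn.
have [e0 he0] : exists e0 : G, head e0 = tail e.
  apply: contrapT => /forallNP noe.
  have := (unique_source G (tail e)).1 (fun g => introN eqP (noe g)).
  by move/(congr1 (@nat_of_ord _)); rewrite te.
apply: (squeeze e0) => //; first by rewrite /alive he0 te ltnSn andbT -ltnS -te -he0 tail_lt_head.
by right; rewrite he0 te.
Qed.

End Order.

(** * The region between two continuous functions *)

Section Strip.
Context (R : realType) (x0 x1 : R) (l u : R -> R).
Context (cl : continuous l) (cu : continuous u).
Implicit Types (q : R * R) (t : R).

Definition strip : set (R * R) :=
  [set q | x0 < q.1 < x1 /\ l q.1 < q.2 < u q.1].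

Definition closed_strip : set (R * R) :=
  [set q | x0 <= q.1 <= x1 /\ l q.1 <= q.2 <= u q.1].

Let below_continuous (q0 : R * R) : {for q0, continuous (fun q => q.2 - l q.1)}.
Proof.
apply: cvgB; first exact: cvg_snd.
apply: (@continuous_comp _ _ _ fst l q0); first exact: cvg_fst.
exact: cl.
Qed.

Let above_continuous (q0 : R * R) : {for q0, continuous (fun q => u q.1 - q.2)}.
Proof.
apply: cvgB; last exact: cvg_snd.
apply: (@continuous_comp _ _ _ fst u q0); first exact: cvg_fst.
exact: cu.
Qed.

Let fst_cont (q0 : R * R) : {for q0, continuous (fun q : R * R => q.1)}.
Proof. exact: cvg_fst. Qed.

Lemma strip_open : open strip.
Proof.
have -> : strip = ((fun q : R * R => q.1) @^-1` [set t | x0 < t] `&`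
    (fun q : R * R => q.1) @^-1` [set t | t < x1]) `&`
    ((fun q => q.2 - l q.1) @^-1` [set t | 0 < t] `&`
     (fun q => u q.1 - q.2) @^-1` [set t | 0 < t]).
  apply/seteqP; split=> q; rewrite /strip /closed_strip /=.
    by case=> /andP[-> ->] /andP[? ?]; rewrite !subr_gt0.
  by case=> -[-> ->]; rewrite !subr_gt0 => -[-> ->].
apply: openI; apply: openI.
- exact: open_comp (fun q _ => @fst_cont q) (@open_gt R _).
- exact: open_comp (fun q _ => @fst_cont q) (@open_lt R _).
- exact: open_comp (fun q _ => @below_continuous q) (@open_gt R _).
- exact: open_comp (fun q _ => @above_continuous q) (@open_gt R _).
Qed.

Lemma closed_strip_closed : closed closed_strip.
Proof.
have -> : closed_strip = ((fun q : R * R => q.1) @^-1` [set t | x0 <= t] `&`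
    (fun q : R * R => q.1) @^-1` [set t | t <= x1]) `&`
    ((fun q => q.2 - l q.1) @^-1` [set t | 0 <= t] `&`
     (fun q => u q.1 - q.2) @^-1` [set t | 0 <= t]).
  apply/seteqP; split=> q; rewrite /strip /closed_strip /=.
    by case=> /andP[-> ->] /andP[? ?]; rewrite !subr_ge0.
  by case=> -[-> ->]; rewrite !subr_ge0 => -[-> ->].
apply: closedI; apply: closedI.
- exact: preimage_closed (fun q _ => @fst_cont q) (@closed_ge R _).
- exact: preimage_closed (fun q _ => @fst_cont q) (@closed_le R _).
- exact: preimage_closed (fun q _ => @below_continuous q) (@closed_ge R _).
- exact: preimage_closed (fun q _ => @above_continuous q) (@closed_ge R _).
Qed.

Context (lu : forall t, x0 < t < x1 -> l t < u t).

(** Every point is joined by a vertical segment to the median line. *)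
Lemma strip_connected : connected strip.
Proof.
pose mid t := (l t + u t) / 2.
pose M := (fun t => (t, mid t)) @` [set` `]x0, x1[].
pose V t := (fun y => (t, y)) @` [set` `]l t, u t[].
have cM : connected M.
  apply: connected_continuous_connected.
    exact/connected_intervalP/interval_is_interval.
  apply: continuous_subspaceT => t.
  apply: (@cvg_pair _ _ _ (nbhs t) (nbhs t) (nbhs (mid t)) _ _ _ id mid); first by move=> ?.
  by apply: cvgM; [apply: cvgD; [exact: cl|exact: cu] | exact: cvg_cst].
have cV t : connected (V t).
  apply: connected_continuous_connected.
    exact/connected_intervalP/interval_is_interval.
  apply: continuous_subspaceT => y.
  by apply: (@cvg_pair _ _ _ (nbhs y) (nbhs t) (nbhs y) _ _ _ (fun=> t) id);
    [exact: cvg_cst | move=> ?].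
have midV t : x0 < t < x1 -> l t < mid t < u t by move=> /lu; rewrite /mid; lra.
have [t0|none] := pselect (exists t, x0 < t < x1); last first.
  suff -> : strip = set0 by exact: connected0.
  by rewrite -subset0 => q [qx _]; apply: none; exists q.1.
have -> : strip = \bigcup_(t in [set t | x0 < t < x1]) (M `|` V t).
  apply/seteqP; split=> [[t y] /= [tx ty]|q [t /= tx [[s]|[y]]]].
  - by exists t => //; right; exists y; rewrite //= in_itv.
  - by rewrite /= in_itv /= => sx <-; split=> //=; apply: midV.
  - by rewrite /= in_itv /= => yx <-; split.
apply: bigcup_connected => [|t tx].
  by case: t0 => t tx; exists (t, mid t) => s sx; left; exists t; rewrite //= in_itv.
apply: connectedU => //; exists (t, mid t); split; first by exists t; rewrite //= in_itv.
by exists (mid t); rewrite //= in_itv /= midV.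
Qed.

(** The strip is open and, relatively to [A], also closed, so a connected subset
    of [A] which meets it cannot leave it. *)
Lemma strip_component (A : set (R * R)) q : strip q -> strip `<=` A ->
  A `&` closed_strip `<=` strip -> strip = connected_component A q.
Proof.
move=> sq sA As; apply/seteqP; split.
  exact: connected_component_max sq sA strip_connected.
pose K := connected_component A q.
have KA : K `<=` A := @connected_component_sub _ A q.
suff KE : K `&` strip = K by rewrite -/K -KE => p [].
have eqKs : K `&` strip = K `&` closed_strip.
  apply/seteqP; split=> p [Kp sp]; split=> //; last by apply: As; split=> //; exact: KA.
  by case: sp => /andP[/ltW h1 /ltW h2] /andP[/ltW h3 /ltW h4]; split; apply/andP.
apply: (component_connected (A := A) (x := q)).
- by exists q; split=> //; apply: connected_component_refl; exact: sA.
- by exists strip => //; exact: strip_open.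
- by exists closed_strip => //; exact: closed_strip_closed.
Qed.

End Strip.

(** * Lenses are bubbles *)

Section Bubbles.
Context (R : realType) (n : nat) (G : flow_graph n) (D : embedding R G).
Implicit Types (e f a b k : G) (u v w : 'I_n.+1) (p q U L : seq G) (i : nat) (t : R).
Local Notation cv := (cv D).

(** The height of a path is written as a sum of increments of prolonged curves,
    which makes its continuity obvious. *)
Definition height u p t : R :=
  vy D u + \sum_(e <- p) (ext D e t - vy D (tail e)).

Lemma height_continuous u p : continuous (height u p).
Proof.
move=> t; apply: cvgD; first exact: cvg_cst.
elim: p => [|e p IHp].
  by under eq_fun do rewrite big_nil; rewrite big_nil; exact: cvg_cst.
under eq_fun do rewrite big_cons; rewrite big_cons; apply: cvgD => //.
by apply: cvgB; [exact: ext_continuous | exact: cvg_cst].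
Qed.

Lemma vx_le u v : (u <= v)%N -> vx D u <= vx D v.
Proof. by rewrite leq_eqVlt => /predU1P[/val_inj -> // | /(vx_incr D)/ltW]. Qed.

Lemma height_start u p w t : is_path u p w -> t <= vx D u -> height u p t = vy D u.
Proof.
move=> pp tu; rewrite /height big_seq big1 ?addr0 // => e ep.
have [ue _] := path_mem_bounds pp ep.
by rewrite ext_tail ?subrr // (le_trans tu) // vx_le.
Qed.

Lemma height_cons u e p t : tail e = u ->
  height u (e :: p) t = ext D e t + height (head e) p t - vy D (head e).
Proof. by move=> <-; rewrite /height big_cons; lra. Qed.

Lemma height_end u p w t : is_path u p w -> vx D w <= t -> height u p t = vy D w.
Proof.
move=> + wt; elim: p u => [|e p IHp] u /=.
  by move=> /eqP ->; rewrite /height big_nil addr0.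
case/andP=> /eqP ue pp; rewrite height_cons // IHp // ext_head; first by lra.
by apply: le_trans wt; apply: vx_le (path_end_le pp).
Qed.

Lemma height_span u p w e t : is_path u p w -> e \in p -> in_span D e t ->
  height u p t = curve D e t.
Proof.
elim: p u => // f p IHp u /= /andP[/eqP uf pp]; rewrite inE => /predU1P[->|ep] et.
  rewrite height_cons // (height_start pp) ?ext_span //; first by lra.
  by case/andP: et.
rewrite height_cons // (IHp _ pp) // ext_head; first by lra.
case/andP: et => et _; apply: le_trans et; apply: vx_le.
by have [] := path_mem_bounds pp ep.
Qed.

Lemma path_span u p w t : is_path u p w -> (u < w)%N -> vx D u <= t <= vx D w ->
  exists2 e, e \in p & in_span D e t.
Proof.
elim: p u => [|e p IHp] u /=; first by move/eqP->; rewrite ltnn.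
case/andP=> /eqP ue pp _ /andP[ut tw]; have [te|et] := leP t (vx D (head e)).
  by exists e; rewrite ?inE ?eqxx // /in_span ue ut.
have [||f fp ft] := IHp _ pp.
- rewrite ltn_neqAle (path_end_le pp) andbT; apply: contraTneq et => ew.
  by rewrite -leNgt (val_inj ew).
- by rewrite (ltW et).
by exists f; rewrite // inE fp orbT.
Qed.

Lemma span_bounds u p w e t : is_path u p w -> e \in p -> in_span D e t ->
  vx D u <= t <= vx D w.
Proof.
move=> pp ep; have [/vx_le ue /vx_le ew] := path_mem_bounds pp ep.
by rewrite /in_span; lra.
Qed.

Lemma gap_in_range u w i t : (i < n)%N -> xv D i <= t <= xv D i.+1 ->
  vx D u < t < vx D w -> (u <= i < w)%N.
Proof.
move=> lin; rewrite !vxE => /andP[it ti] /andP[ut tw]; apply/andP; split.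
  rewrite leqNgt; apply/negP => iu; have := @xv_le R n G D i.+1 u.
  by rewrite iu -ltnS ltn_ord => /(_ isT); lra.
rewrite ltnNge; apply/negP => wi; have := @xv_le R n G D w i.
by rewrite wi (ltnW lin) => /(_ isT); lra.
Qed.

(** The abscissae of the two ends are excluded since both paths have the same
    height there. *)
Lemma between_strip U L u w : (u < w)%N -> is_path u U w -> is_path u L w ->
  between D U L = strip (vx D u) (vx D w) (height u L) (height u U).
Proof.
move=> uw Up Lp; apply/seteqP; split=> q.
  case=> e [f [eU fL eq fq /andP[lf lu]]].
  rewrite /strip /= (height_span Up eU eq) (height_span Lp fL fq) lf lu; split=> //.
  have /andP[uq qw] := span_bounds Up eU eq.
  rewrite !lt_neqAle uq qw !andbT; apply/andP; split; apply/eqP => eqq.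
    move: lf lu; rewrite -(height_span Up eU eq) -(height_span Lp fL fq).
    by rewrite (height_start Up) ?eqq // (height_start Lp) ?eqq //; lra.
  move: lf lu; rewrite -(height_span Up eU eq) -(height_span Lp fL fq).
  by rewrite (height_end Up) ?eqq // (height_end Lp) ?eqq //; lra.
case=> /andP[/ltW uq /ltW qw] /andP[lq qu].
have [|e eU eq] := path_span (t := q.1) Up uw; first by rewrite uq.
have [|f fL fq] := path_span (t := q.1) Lp uw; first by rewrite uq.
exists e, f; split=> //.
by rewrite -(height_span Up eU eq) -(height_span Lp fL fq) lq.
Qed.

Section Lens.
Context u w U L (UL : lens D u w U L).
Let uw := lens_lt UL.
Let Up := lens_up UL.
Let Lp := lens_low UL.

Lemma lens_gap i : (u <= i < w)%N ->
  exists a b, [/\ a \in U, b \in L, alive a i & alive b i].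
Proof.
move=> ui; have [a aU ai] := path_alive Up ui; have [b bL bi] := path_alive Lp ui.
by exists a, b.
Qed.

(** Over the gaps this is [lens_sep].  Equal heights elsewhere would occur at a
    vertex through which both paths pass. *)
Lemma lens_height_lt t : vx D u < t < vx D w -> height u L t < height u U t.
Proof.
move=> tuw; have /andP[ut tw] := tuw.
have [|e eU et] := path_span (t := t) Up uw; first by rewrite !ltW.
have [i [ui iw]] : exists i, (u <= i < w)%N /\ xv D i <= t < xv D i.+1.
  have [i ei it] := span_gap et.
  have ui := gap_in_range (alive_lt ei) it tuw; case/andP: it => it ti.
  have [ti'|it'] := ltP t (xv D i.+1); first by exists i; rewrite ui it.
  have tE : t = xv D i.+1 by apply/le_anti; rewrite ti.
  have i1w : (i.+1 < w)%N.
    rewrite ltn_neqAle; case/andP: ui => _ ->; rewrite andbT.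
    by apply: contraTneq tw => iw; rewrite -leNgt tE vxE iw.
  exists i.+1; rewrite i1w andbT; split; first by case/andP: ui => /leqW.
  by rewrite tE lexx; apply: xv_lt; rewrite ltnSn (leq_trans i1w) // -ltnS.
case/andP: iw => it ti.
have [a [b [aU bL ai bi]]] := lens_gap ui.
have lt_ba := lens_sep UL aU bL ai bi.
have ab : a != b by apply: contraTneq lt_ba => ->; rewrite ltxx.
have tii : xv D i <= t <= xv D i.+1 by rewrite it ltW.
have sa := alive_span ai tii; have sb := alive_span bi tii.
rewrite (height_span Up aU sa) (height_span Lp bL sb) lt_neqAle.
rewrite (gap_le bi ai tii (ltW lt_ba)) andbT.
have [ta1 ta2] := alive_gap D ai; have [tb1 tb2] := alive_gap D bi.
have [at_|at_] := boolP (vx D (tail a) < t).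
  rewrite eq_sym; apply: curve_crossing_free => //.
  by rewrite at_ (lt_le_trans ti).
have [bt_|bt_] := boolP (vx D (tail b) < t).
  by apply: curve_crossing_free; rewrite 1?eq_sym // bt_ (lt_le_trans ti).
(* both paths would pass through the vertex at abscissa [t] *)
have tail_i (c : G) : alive c i -> ~~ (vx D (tail c) < t) -> tail c = i :> nat.
  move=> ci; rewrite -leNgt => tc; apply/eqP; rewrite eqn_leq; case/andP: (ci) => -> _ /=.
  rewrite leqNgt; apply/negP => lt_ci; have := @xv_lt R n G D (tail c) i.
  by rewrite lt_ci (ltnW (alive_lt ci)) -vxE => /(_ isT); lra.
have ta := tail_i a ai at_; have tb := tail_i b bi bt_.
have tab : tail a = tail b by apply/val_inj; rewrite /= ta tb.
by move: at_; rewrite (lens_vertex UL aU bL tab) ut.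
Qed.

(** A point of the drawing inside the lens would lie on an edge, and this edge
    would run inside the lens over an adjacent gap. *)
Lemma lens_avoids_drawing : between D U L `<=` ~` drawing D.
Proof.
rewrite (between_strip uw Up Lp) => q [quw /andP[lq qu]] dq.
have [e eq q2] : exists2 e, in_span D e q.1 & q.2 = curve D e q.1.
  case: dq => // -[v qv].
  have [e ev] : exists e : G, head e = v.
    apply: contrapT => /forallNP noe.
    have v0 := (unique_source G v).1 (fun g => introN eqP (noe g)).
    by move: quw; rewrite qv v0 /= => /andP[+ _]; rewrite ltNge vx_le.
  exists e; rewrite qv -ev /= ?curve_head //.
  by rewrite /in_span lexx span_le.
have [i ei iq] := span_gap eq.
have [a [b [aU bL ai bi]]] := lens_gap (gap_in_range (alive_lt ei) iq quw).
have qa := height_span Up aU (alive_span ai iq).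
have qb := height_span Lp bL (alive_span bi iq).
apply: (lens_void UL aU bL ai bi ei); rewrite !ltNge.
apply/andP; split; apply/negP => le_cv.
  by move: lq; rewrite qb q2 ltNge (gap_le ei bi iq le_cv).
by move: qu; rewrite qa q2 ltNge (gap_le ai ei iq le_cv).
Qed.

Lemma lens_bubble : bubble D U L.
Proof.
have lt_LU := lens_height_lt; split.
  exists u, w; split=> // e f t eU fL tuw et ft.
  by rewrite -(height_span Up eU et) -(height_span Lp fL ft); apply: lt_LU.
pose x := (vx D u + vx D w) / 2.
have ux : vx D u < x < vx D w by have := vx_incr D uw; rewrite /x; lra.
pose y := (height u L x + height u U x) / 2.
have sxy : between D U L (x, y).
  rewrite (between_strip uw Up Lp); split=> //=.
  by have := lt_LU x ux; rewrite /y; lra.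
exists (x, y); first exact: lens_avoids_drawing.
have := lens_avoids_drawing; move: sxy.
rewrite (between_strip uw Up Lp) => sxy sD.
apply: strip_component => //; try exact: height_continuous.
move=> q [nq [/andP[uq qw] /andP[lq qu]]].
have dU : q.2 != height u U q.1.
  apply: contra_notN nq => /eqP qE; right.
  have [|e eU et] := path_span (t := q.1) Up uw; first by rewrite uq.
  by exists e; rewrite // qE (height_span Up eU et).
have dL : q.2 != height u L q.1.
  apply: contra_notN nq => /eqP qE; right.
  have [|e eL et] := path_span (t := q.1) Lp uw; first by rewrite uq.
  by exists e; rewrite // qE (height_span Lp eL et).
split; last by rewrite !lt_neqAle lq qu dU eq_sym dL.
rewrite !lt_neqAle uq qw !andbT; apply/andP; split; apply/eqP => qE.
  apply: nq; left; exists u; move: lq qu.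
  rewrite (height_start Up) ?qE // (height_start Lp) ?qE // => lq qu.
  by rewrite (surjective_pairing q); apply/pair_equal_spec; split=> //; lra.
apply: nq; left; exists w; move: lq qu.
rewrite (height_end Up) ?qE // (height_end Lp) ?qE // => lq qu.
by rewrite (surjective_pairing q); apply/pair_equal_spec; split=> //; lra.
Qed.

End Lens.
End Bubbles.

(** * Bubbles, their order and their order ideals *)

Section BubbleOrder.
Context (R : realType) (n : nat) (G : flow_graph n) (D : embedding R G).
Context (F : framing G) (hF : induced_framing D F).
Implicit Types (e f g a b k p q : G) (u v w : 'I_n.+1) (U L : seq G) (i : nat) (t : R).
Implicit Types (P Q : route G).
Local Notation cv := (cv D).

Lemma bubble_paths U L : bubble D U L -> exists u w,
  [/\ (u < w)%N, is_path u U w, is_path u L w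
    & forall i a b, a \in U -> b \in L -> alive a i -> alive b i -> cv b i < cv a i].
Proof.
case=> [[u [w [uw Up Lp sep]]] _]; exists u, w; split=> // i a b aU bL ai bi.
have am := alive_mid D ai; have bm := alive_mid D bi.
apply: sep => //; try by rewrite /in_span; lra.
have [/(vx_le D) ua /(vx_le D) aw] := path_mem_bounds Up aU; lra.
Qed.

Lemma between_mid u w U L i a b y : is_path u U w -> is_path u L w ->
  a \in U -> b \in L -> alive a i -> alive b i ->
  between D U L (mid D i, y) <-> cv b i < y < cv a i.
Proof.
move=> Up Lp aU bL ai bi; split=> [[e [f [eU fL /= eq fq]]]|byA].
  have ein := alive_lt ai.
  rewrite (path_alive_inj Up eU aU (mid_alive ein eq) ai).
  by rewrite (path_alive_inj Lp fL bL (mid_alive ein fq) bi).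
exists a, b; split=> //=; have := alive_mid D ai; have := alive_mid D bi;
  by rewrite /in_span; lra.
Qed.

Lemma subinterval_bounds (x y x' y' : R) : x < y ->
  (forall z, x < z < y -> x' < z < y') -> x' <= x /\ y <= y'.
Proof.
move=> xy sub; split; rewrite leNgt; apply/negP => lt.
  have := sub ((x + Num.min y x') / 2); rewrite /Num.min; case: ifP => yx'; lra.
have := sub ((y + Num.max x y') / 2); rewrite /Num.max; case: ifP => xy'; lra.
Qed.

Lemma between_sub U L U' L' u w u' w' :
  is_path u U w -> is_path u L w -> is_path u' U' w' -> is_path u' L' w' ->
  (forall i a b, a \in U -> b \in L -> alive a i -> alive b i -> cv b i < cv a i) ->
  between D U L `<=` between D U' L' ->
  forall i, (u <= i < w)%N -> (u' <= i < w')%N /\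
    forall a b a' b', a \in U -> b \in L -> a' \in U' -> b' \in L' ->
      alive a i -> alive b i -> alive a' i -> alive b' i ->
      cv b' i <= cv b i /\ cv a i <= cv a' i.
Proof.
move=> Up Lp Up' Lp' sep sub i uiw.
have [a aU ai] := path_alive Up uiw; have [b bL bi] := path_alive Lp uiw.
have ilt := alive_lt ai; have lt_ba := sep _ _ _ aU bL ai bi.
split=> [|{aU bL ai bi lt_ba}a {}b a' b' aU bL a'U b'L ai bi a'i b'i].
  have : between D U L (mid D i, (cv b i + cv a i) / 2).
    by apply/(between_mid _ Up Lp aU bL ai bi); lra.
  case/sub => e [_ [eU' _ /(mid_alive ilt) ei _ _]]; exact: path_range Up' eU' ei.
apply: subinterval_bounds; first exact: sep.
move=> z /(between_mid _ Up Lp aU bL ai bi) /sub.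
by move/(between_mid _ Up' Lp' a'U b'L a'i b'i).
Qed.

(** Both regions are the connected component of the common point, and a region
    determines its two boundary paths. *)
Lemma bubble_inj U L U' L' (z : R * R) : bubble D U L -> bubble D U' L' ->
  between D U L z -> between D U' L' z -> U = U' /\ L = L'.
Proof.
move=> bUL bUL' zUL zUL'.
have [u [w [uw Up Lp sep]]] := bubble_paths bUL.
have [u' [w' [uw' Up' Lp' sep']]] := bubble_paths bUL'.
have eqB : between D U L = between D U' L'.
  case: bUL bUL' => _ [z1 _ E1] [_ [z2 _ E2]]; move: zUL zUL'; rewrite E1 E2.
  by move=> /same_connected_component-> /same_connected_component->.
have := between_sub Up Lp Up' Lp' sep; have := between_sub Up' Lp' Up Lp sep'.
rewrite eqB => /(_ (@subset_refl _ _)) sub' /(_ (@subset_refl _ _)) sub.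
have ends v x v' x' : (v < x)%N -> (v' < x')%N ->
    (forall i, (v <= i < x)%N -> (v' <= i < x')%N) -> (v' <= v)%N /\ (x <= x')%N.
  move=> lt_vx lt_vx' incl; have [|-> _] := andP (incl v _); first by rewrite leqnn.
  by have [|_] := andP (incl x.-1 _); [lia | lia].
have [u'u ww'] := ends _ _ _ _ uw uw' (fun i ui => (sub i ui).1).
have [uu' w'w] := ends _ _ _ _ uw' uw (fun i ui => (sub' i ui).1).
have eu : u = u' by apply/val_inj/eqP; rewrite eqn_leq uu'.
have ew : w = w' by apply/val_inj/eqP; rewrite eqn_leq ww'.
subst u' w'; have eq_cv i a b a' b' : a \in U -> b \in L -> a' \in U' -> b' \in L' ->
    alive a i -> alive b i -> alive a' i -> alive b' i -> a = a' /\ b = b'.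
  move=> aU bL a'U b'L ai bi a'i b'i; have uiw := path_range Up aU ai.
  have [b'b aa'] := (sub i uiw).2 _ _ _ _ aU bL a'U b'L ai bi a'i b'i.
  have [bb' a'a] := (sub' i uiw).2 _ _ _ _ a'U b'L aU bL a'i b'i ai bi.
  by split; [apply: (cv_inj (D := D) ai a'i) | apply: (cv_inj (D := D) bi b'i)];
    apply/le_anti/andP.
split; apply: path_sub_eq; [exact: Up|exact: Up'| |exact: Lp|exact: Lp'|].
  move=> a' a'U; have a'i := alive_tail a'; have uiw := path_range Up' a'U a'i.
  have [a aU ai] := path_alive Up uiw; have [b bL bi] := path_alive Lp uiw.
  have [b' b'L b'i] := path_alive Lp' uiw.
  by have [<- _] := eq_cv _ _ _ _ _ aU bL a'U b'L ai bi a'i b'i.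
move=> b' b'L; have b'i := alive_tail b'; have uiw := path_range Lp' b'L b'i.
have [a aU ai] := path_alive Up uiw; have [b bL bi] := path_alive Lp uiw.
have [a' a'U a'i] := path_alive Up' uiw.
by have [_ <-] := eq_cv _ _ _ _ _ aU bL a'U b'L ai bi a'i b'i.
Qed.

Lemma ohead_behead (T : Type) (s : seq T) x : ohead s = Some x -> s = x :: behead s.
Proof. by case: s => //= y s [->]. Qed.

Lemma bubble_at_paths k U L : bubble_at D k U L -> exists w,
  [/\ U = k :: behead U, is_path (tail k) U w, is_path (tail k) L w, (tail k < w)%N
    & forall i a b, a \in U -> b \in L -> alive a i -> alive b i -> cv b i < cv a i].
Proof.
move=> [bUL hdU]; have UE := ohead_behead hdU.
have [u [w [uw Up Lp sep]]] := bubble_paths bUL.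
have uk : u = tail k by move: Up; rewrite UE => /andP[/eqP].
by subst u; exists w.
Qed.

Lemma bubble_at_unique k U L U' L' : bubble_at D k U L -> bubble_at D k U' L' ->
  U = U' /\ L = L'.
Proof.
move=> bk bk'; have [w [UE Up Lp kw sep]] := bubble_at_paths bk.
have [w' [UE' Up' Lp' kw' sep']] := bubble_at_paths bk'.
have [|b bL bi] := path_alive Lp (i := tail k); first by rewrite leqnn.
have [|b' b'L b'i] := path_alive Lp' (i := tail k); first by rewrite leqnn.
have kU : k \in U by rewrite UE inE eqxx.
have kU' : k \in U' by rewrite UE' inE eqxx.
have ki := alive_tail k.
have bk_lt := sep _ _ _ kU bL ki bi; have bk_lt' := sep' _ _ _ kU' b'L ki b'i.
pose y := (Num.max (cv b (tail k)) (cv b' (tail k)) + cv k (tail k)) / 2.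
have [by_ b'y yk] : [/\ cv b (tail k) < y, cv b' (tail k) < y & y < cv k (tail k)].
  by rewrite /y /Num.max; case: ifP => bb'; split; lra.
apply: (@bubble_inj _ _ _ _ (mid D (tail k), y) (proj1 bk) (proj1 bk')).
  by apply/(between_mid _ Up Lp kU bL ki bi); rewrite by_.
by apply/(between_mid _ Up' Lp' kU' b'L ki b'i); rewrite b'y.
Qed.

Lemma bubble_at_level k U L : bubble_at D k U L -> (0 < level F k)%N.
Proof.
move=> bk; have [w [UE Up Lp kw sep]] := bubble_at_paths bk.
have [|b bL bi] := path_alive Lp (i := tail k); first by rewrite leqnn.
apply/(level_gt0P hF); exists b; last first.
  by apply: sep bi => //; [rewrite UE inE eqxx | exact: alive_tail].
apply/val_inj/eqP; rewrite eqn_leq; case/andP: bi => -> _ /=.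
by have [] := path_mem_bounds Lp bL.
Qed.

Lemma bubble_at_exists k : (0 < level F k)%N -> exists w U L,
  [/\ lens D (tail k) w (k :: U) L, all (extreme D true) U & bubble_at D k (k :: U) L].
Proof.
move=> /(level_gt0P hF)[f0 f0k lt_f0].
pose below f := (tail f == tail k) && (cv f (tail k) < cv k (tail k)).
have below0 : below f0 by rewrite /below f0k eqxx.
have [f /andP[/eqP fk lt_fk] fmax] := @arg_maxP _ R G f0 below (fun f => cv f (tail k)) below0.
have [e ek /andP[lt_fe lt_ek]|w [U [L [UL Ulow _]]]] := lens_exists fk lt_fk.
  have be : below e by rewrite /below ek eqxx.
  by have /(_ e be)/= := fmax; rewrite leNgt lt_fe.
by exists w, U, (f :: L); split=> //; split=> //; exact: lens_bubble UL.
Qed.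

Lemma low_level_all k U : all (extreme D true) U -> k \in U -> level F k = 0%N.
Proof. by move=> /allP low /low; rewrite (low_level hF) => /eqP. Qed.

(** After the first one the edges of the upper boundary are bottommost: an edge
    leaving below one of them would enter the bubble. *)
Lemma bubble_upper_level k g U L : bubble_at D k U L -> g \in U ->
  (0 < level F g)%N -> g = k.
Proof.
move=> bk gU lg; have [w [U' [L' [_ low bk']]]] := bubble_at_exists (bubble_at_level bk).
move: gU; rewrite (bubble_at_unique bk bk').1 inE => /predU1P[//|/(low_level_all low)].
by move=> g0; rewrite g0 in lg.
Qed.

(** A point just above [g] lies in both bubbles. *)
Lemma bubble_lower_inj g k k' U L U' L' : bubble_at D k U L -> bubble_at D k' U' L' ->
  g \in L -> g \in L' -> k = k'.
Proof.
move=> bk bk' gL gL'; have [w [UE Up Lp kw sep]] := bubble_at_paths bk.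
have [w' [UE' Up' Lp' kw' sep']] := bubble_at_paths bk'.
have gi := alive_tail g.
have [a aU ai] := path_alive Up (path_range Lp gL gi).
have [a' a'U a'i] := path_alive Up' (path_range Lp' gL' gi).
have ga := sep _ _ _ aU gL ai gi; have ga' := sep' _ _ _ a'U gL' a'i gi.
pose y := (Num.min (cv a (tail g)) (cv a' (tail g)) + cv g (tail g)) / 2.
have [ya ya' gy] : [/\ y < cv a (tail g), y < cv a' (tail g) & cv g (tail g) < y].
  by rewrite /y /Num.min; case: ifP => aa'; split; lra.
have [||UU' _] := @bubble_inj _ _ _ _ (mid D (tail g), y) (proj1 bk) (proj1 bk').
- by apply/(between_mid _ Up Lp aU gL ai gi); rewrite gy.
- by apply/(between_mid _ Up' Lp' a'U gL' a'i gi); rewrite gy.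
by move: UE; rewrite UU' UE' => -[].
Qed.

(** The shared edge is not bottommost, so it must be the first edge of the upper
    boundary of the lower bubble: this is [g] itself. *)
Lemma share_upper_edgeP k g U L : bubble_at D k U L ->
  share_edge_below D [pred g | (0 < level F g)%N] g k <-> g \in L /\ (0 < level F g)%N.
Proof.
move=> bk; split=> [[Ug [Lg [Uk [Lk [x [bg bk' xU xL lx]]]]]]|[gL lg]].
  have xg : x = g := bubble_upper_level bg xU lx.
  by subst x; rewrite (bubble_at_unique bk bk').2.
have [w [Ug [Lg [_ _ bg]]]] := bubble_at_exists lg.
by exists (g :: Ug), Lg, U, L, g; split=> //; rewrite inE eqxx.
Qed.

(** A route which is not below the first edge of the upper boundary of a bubble
    stays above the whole bubble, because the remaining edges of this boundary
    are bottommost and cannot be crossed downwards.  So membership in the ideal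
    is decided over a single gap. *)
Lemma order_idealP P k : k \in order_ideal D P <->
  (0 < level F k)%N /\
  forall b, b \in (P : seq G) -> alive b (tail k) -> cv k (tail k) <= cv b (tail k).
Proof.
rewrite inE; split=> [/asboolP[U [L [bk below]]]|[lk kP]].
  split=> [|c cP ci]; first exact: bubble_at_level bk.
  have [w [UE Up Lp kw sep]] := bubble_at_paths bk.
  have [|b bL bi] := path_alive Lp (i := tail k); first by rewrite leqnn.
  have kU : k \in U by rewrite UE inE eqxx.
  have ki := alive_tail k; have lt_bk := sep _ _ _ kU bL ki bi.
  rewrite leNgt; apply/negP => lt_ck.
  pose y := (Num.max (cv b (tail k)) (cv c (tail k)) + cv k (tail k)) / 2.
  have [by_ cy yk] : [/\ cv b (tail k) < y, cv c (tail k) < y & y < cv k (tail k)].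
    by rewrite /y /Num.max; case: ifP => bc; split; lra.
  have : y < cv c (tail k).
    apply: (below (mid D (tail k), y) c _ cP).
      by apply/(between_mid _ Up Lp kU bL ki bi); rewrite by_.
    by have := alive_mid D ci; rewrite /in_span /=; lra.
  by rewrite ltNge ltW.
have [w [U [L [UL low bk]]]] := bubble_at_exists lk.
apply/asboolP; exists (k :: U), L; split=> // q c qUL cP cq.
have le_UP := extreme_path (lens_up UL) low kP.
case: qUL => e [f [eU fL eq fq /andP[_ q_lt]]]; apply: (lt_le_trans q_lt).
have [i ei iq] := span_gap eq; have [b bP bi] := route_alive P (alive_lt ei).
rewrite -(height_span (routeP P) cP cq) (height_span (routeP P) bP (alive_span bi iq)).
exact: gap_le ei bi iq (le_UP _ _ _ eU bP ei bi).
Qed.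

End BubbleOrder.

(** * Routes ordered from bottom to top, and coherence *)

Section Routes.
Context (R : realType) (n : nat) (G : flow_graph n) (D : embedding R G).
Context (F : framing G) (hF : induced_framing D F).
Implicit Types (e f g a b c k : G) (u v w : 'I_n.+1) (U L A B : seq G) (i j l : nat).
Implicit Types (P Q S : route G).
Local Notation cv := (cv D).

Definition route_le P Q := forall i a b, a \in (P : seq G) -> b \in (Q : seq G) ->
  alive a i -> alive b i -> cv a i <= cv b i.

Lemma route_alive_inj P i a b : a \in (P : seq G) -> b \in (P : seq G) ->
  alive a i -> alive b i -> a = b.
Proof. exact: path_alive_inj (routeP P). Qed.

Lemma route_consecutive P i a b : a \in (P : seq G) -> b \in (P : seq G) ->
  alive a i -> alive b i.+1 -> consecutive i a b.
Proof. exact: path_consecutive (routeP P). Qed.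

Lemma route_le_refl P : route_le P P.
Proof. by move=> i a b aP bP ai bi; rewrite (route_alive_inj aP bP ai bi). Qed.

Lemma route_le_trans Q P S : route_le P Q -> route_le Q S -> route_le P S.
Proof.
move=> PQ QS i a c aP cS ai ci; have [b bQ bi] := route_alive Q (alive_lt ai).
exact: le_trans (PQ _ _ _ aP bQ ai bi) (QS _ _ _ bQ cS bi ci).
Qed.

Lemma route_sub_eq P Q : {subset (P : seq G) <= (Q : seq G)} -> P = Q.
Proof. by move=> PQ; apply/route_inj/esym/(path_sub_eq (routeP Q) (routeP P)). Qed.

Lemma route_le_anti P Q : route_le P Q -> route_le Q P -> P = Q.
Proof.
move=> PQ QP; apply: route_sub_eq => a aP; have ai := alive_tail a.
have [b bQ bi] := route_alive Q (alive_lt ai).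
rewrite (cv_inj (D := D) ai bi) //; apply/le_anti.
by rewrite (PQ _ _ _ aP bQ ai bi) (QP _ _ _ bQ aP bi ai).
Qed.

(** If [a] already passed over the previous gap, where the routes agree, then [Q]
    would follow [a] too. *)
Lemma route_split P Q i a b : a \in (P : seq G) -> b \in (Q : seq G) ->
  alive a i -> alive b i -> a != b ->
  (forall l c d, i = l.+1 -> c \in (P : seq G) -> d \in (Q : seq G) ->
     alive c l -> alive d l -> c = d) ->
  tail a = i :> nat.
Proof.
move=> aP bQ ai bi ab before; apply/eqP; rewrite eqn_leq; case/andP: (ai) => -> _ /=.
case: i ai bi before => // i ai bi before; rewrite leqNgt; apply/negP => ta.
have ai' : alive a i by move: ai ta; rewrite /alive; clear; lia.
have [d dQ di] := route_alive Q (alive_lt ai').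
have ad := before _ _ _ erefl aP dQ ai' di; subst d.
by move/eqP: ab; apply; apply: route_alive_inj dQ bQ ai bi.
Qed.

(** At the first gap over which the routes differ, both have just left the same
    vertex. *)
Lemma route_diverge P Q : route_le P Q -> P <> Q ->
  exists a b, [/\ a \in (P : seq G), b \in (Q : seq G), tail a = tail b
    & cv a (tail a) < cv b (tail a)].
Proof.
move=> PQ neqPQ.
pose differ i := [exists a, exists b, [&& a \in (P : seq G), b \in (Q : seq G),
  alive a i, alive b i & a != b]].
have exd : exists i, differ i.
  apply: contrapT => /forallNP same; apply: neqPQ; apply: route_sub_eq => a aP.
  have ai := alive_tail a; have [b bQ bi] := route_alive Q (alive_lt ai).
  have [<- //|ab] := eqVneq b a; exfalso; apply: (same (tail a)).
  by apply/existsP; exists a; apply/existsP; exists b; rewrite aP bQ ai bi eq_sym.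
case: (ex_minnP exd) => i /existsP[a /existsP[b /and5P[aP bQ ai bi ab]]] imin.
have before l c d : i = l.+1 -> c \in (P : seq G) -> d \in (Q : seq G) ->
    alive c l -> alive d l -> c = d.
  move=> il cP dQ cl dl; apply/eqP/negPn/negP => cd.
  have /imin : differ l.
    by apply/existsP; exists c; apply/existsP; exists d; rewrite cP dQ cl dl.
  by rewrite il ltnn.
have ta := route_split aP bQ ai bi ab before.
have tb : tail b = i :> nat.
  rewrite eq_sym in ab; apply: (route_split bQ aP bi ai ab) => l c d il cQ dP cl dl.
  exact/esym/(before l).
exists a, b; split=> //; first by apply/val_inj; rewrite /= ta tb.
rewrite ta lt_neqAle (PQ _ _ _ aP bQ ai bi) andbT.
by apply: contraNneq ab => /(cv_inj ai bi)->.
Qed.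

Lemma upto_cat A B v : is_path ord0 A v -> is_path v B ord_max -> upto (A ++ B) v = A.
Proof.
move=> Av Bv; rewrite /upto filter_cat.
have /all_filterP-> : all (fun e => (head e <= v)%N) A.
  by apply/allP => e eA; have [] := path_mem_bounds Av eA.
rewrite (@eq_in_filter _ _ pred0) ?filter_pred0 ?cats0 // => e eB /=.
have [ve _] := path_mem_bounds Bv eB; apply/negbTE; rewrite -ltnNge.
exact: leq_ltn_trans ve (tail_lt_head e).
Qed.

Lemma from_cat A B v : is_path ord0 A v -> is_path v B ord_max -> from (A ++ B) v = B.
Proof.
move=> Av Bv; rewrite /from filter_cat.
have /all_filterP-> : all (fun e => (v <= tail e)%N) B.
  by apply/allP => e eB; have [] := path_mem_bounds Bv eB.
rewrite (@eq_in_filter _ _ pred0) ?filter_pred0 // => e eA /=.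
have [_ ev] := path_mem_bounds Av eA; apply/negbTE; rewrite -ltnNge.
exact: leq_trans (tail_lt_head e) ev.
Qed.

(** Consider the first gap after [i0] over which [P] is below [Q], and the last gap
    before it over which [P] is above [Q].  In between the routes coincide, and
    they enter this common part and leave it in opposite orders. *)
Lemma crossing_incoherent P Q i0 j0 : (i0 < j0)%N ->
  (exists a b, [/\ a \in (P : seq G), b \in (Q : seq G), alive a i0, alive b i0
     & cv b i0 < cv a i0]) ->
  (exists a b, [/\ a \in (P : seq G), b \in (Q : seq G), alive a j0, alive b j0
     & cv a j0 < cv b j0]) ->
  ~ coherent F P Q.
Proof.
move=> ij0 gt0 lt0 coh.
pose gt i := [exists a, exists b, [&& a \in (P : seq G), b \in (Q : seq G),
  alive a i, alive b i & cv b i < cv a i]].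
pose lt i := [exists a, exists b, [&& a \in (P : seq G), b \in (Q : seq G),
  alive a i, alive b i & cv a i < cv b i]].
have {}gt0 : gt i0.
  by case: gt0 => a [b [? ? ? ? ?]]; apply/existsP; exists a; apply/existsP;
    exists b; apply/and5P.
have {}lt0 : exists j, (i0 < j)%N && lt j.
  by case: lt0 => a [b [? ? ? ? ?]]; exists j0; rewrite ij0; apply/existsP; exists a;
    apply/existsP; exists b; apply/and5P.
case: (ex_minnP lt0) => j /andP[i0j ltj] jmin.
have exi : exists i, (i < j)%N && gt i by exists i0; rewrite i0j.
have ubi i : (i < j)%N && gt i -> (i <= j)%N by case/andP=> /ltnW.
case: (ex_maxnP exi ubi) => i /andP[ij gti] imax.
have i0i : (i0 <= i)%N by apply: imax; rewrite i0j.
have same l a b : (i < l < j)%N -> a \in (P : seq G) -> b \in (Q : seq G) ->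
    alive a l -> alive b l -> a = b.
  move=> /andP[il lj] aP bQ al bl; apply: (cv_inj (D := D) al bl); apply/eqP.
  rewrite eq_le !leNgt; apply/andP; split; apply/negP => ab.
    have : gt l by apply/existsP; exists a; apply/existsP; exists b; apply/and5P.
    by move=> gtl; have := imax l; rewrite lj gtl leqNgt il => /(_ isT).
  have : lt l by apply/existsP; exists a; apply/existsP; exists b; apply/and5P.
  by move=> ltl; have := jmin l; rewrite (leq_ltn_trans i0i il) ltl leqNgt lj => /(_ isT).
case/existsP: gti => a /existsP[b /and5P[aP bQ ai bi lt_ba]].
case/existsP: ltj => c /existsP[d /and5P[cP dQ cj dj lt_cd]].
have ab : a != b by apply: contraTneq lt_ba => ->; rewrite ltxx.
have cd : c != d by apply: contraTneq lt_cd => ->; rewrite ltxx.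
have i1n : (i.+1 < n)%N := leq_ltn_trans ij (alive_lt cj).
have [a' a'P a'i] := route_alive P i1n; have [b' b'Q b'i] := route_alive Q i1n.
have ca := route_consecutive aP a'P ai a'i; have cb := route_consecutive bQ b'Q bi b'i.
(* both routes pass through the vertex after the gap [i] *)
have [ta' tb'] : tail a' = i.+1 :> nat /\ tail b' = i.+1 :> nat.
  have [ij1|ji1] := ltnP i.+1 j.
    have ab' : a' = b' by apply: (same i.+1); rewrite // ltnSn ij1.
    subst b'; suff: tail a' = i.+1 :> nat by [].
    case: ca cb => [aa'|[] //] [ba'|[] //].
    by move: ab; rewrite aa' ba' eqxx.
  have ji : j = i.+1 by apply/eqP; rewrite eqn_leq ji1.
  subst j; apply: contrapT => nab.
  have := consecutive_lt bi ai b'i a'i cb ca (fun H => nab (conj H.2 H.1)) lt_ba.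
  rewrite (route_alive_inj a'P cP a'i cj) (route_alive_inj b'Q dQ b'i dj).
  by rewrite ltNge ltW.
have pass e e' : consecutive i e e' -> alive e i -> tail e' = i.+1 :> nat ->
    head e = i.+1 :> nat.
  by case=> [->|[]//]; rewrite /alive => /andP[+ _] te; rewrite te ltnn.
have ha := pass _ _ ca ai ta'; have hb := pass _ _ cb bi tb'.
pose v := tail a'; have vE : v = i.+1 :> nat := ta'.
have tb'v : tail b' = v by apply/val_inj; rewrite /= tb' vE.
have hav : head a = v by apply/val_inj; rewrite /= ha vE.
have hbv : head b = v by apply/val_inj; rewrite /= hb vE.
have parts S e e' g : e \in (S : seq G) -> head e = v -> e' \in (S : seq G) ->
    tail e' = v -> g \in (S : seq G) -> alive g j -> tail g = j :> nat ->
  exists p s r, [/\ upto S v = p ++ [:: e], from S v = s ++ g :: r,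
    is_path v s (tail g) & {subset s <= (S : seq G)}].
  move=> eS ev e'S e'v gS gj tg.
  have [X [Y [SE Xp Yp]]] := path_cut_tail (routeP S) e'S; rewrite e'v in Xp.
  have eYp : is_path v (e' :: Y) ord_max by rewrite /= e'v eqxx.
  have eX : e \in X.
    move: eS; rewrite SE mem_cat => /orP[//|/(path_mem_bounds eYp)[+ _]].
    by rewrite -ev leqNgt tail_lt_head.
  have gY : g \in e' :: Y.
    move: gS; rewrite SE mem_cat => /orP[/(path_mem_bounds Xp)[_]|//].
    by move=> gv; case/andP: gj => _; rewrite ltnNge (leq_trans gv) // vE.
  have [p [q [XE pp qq]]] := path_cut_tail Xp eX; rewrite ev in qq.
  have qnil : q = [::].
    case: q qq {XE} => //= h q /andP[/eqP <- /path_end_le].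
    by rewrite leqNgt tail_lt_head.
  have [s [r [YE sp rp]]] := path_cut_tail eYp gY.
  exists p, s, r; rewrite SE (upto_cat Xp eYp) (from_cat Xp eYp) -qnil; split=> //.
  by move=> x xs; rewrite mem_cat YE mem_cat xs orbT.
have before l x y : j = l.+1 -> (i < l)%N -> x \in (P : seq G) -> y \in (Q : seq G) ->
    alive x l -> alive y l -> x = y.
  by move=> jl il; apply: same; rewrite il jl ltnSn.
have [tc td] : tail c = j :> nat /\ tail d = j :> nat.
  have [ij1|ji1] := ltnP i.+1 j; last first.
    have ji : j = i.+1 by apply/eqP; rewrite eqn_leq ji1.
    by subst j; rewrite -(route_alive_inj a'P cP a'i cj) -(route_alive_inj b'Q dQ b'i dj).
  split.
    apply: (route_split cP dQ cj dj cd) => l x y jl; apply: before => //.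
    by rewrite -ltnS -jl.
  rewrite eq_sym in cd; apply: (route_split dQ cP dj cj cd) => l x y jl xQ yP xl yl.
  by apply/esym/(before l); rewrite // -ltnS -jl.
have tcd : tail c = tail d by apply/val_inj; rewrite /= tc td.
have [p1 [s1 [r1 [up1 fr1 s1p s1P]]]] := parts _ _ _ _ aP hav a'P erefl cP cj tc.
have [p2 [s2 [r2 [up2 fr2 s2p s2Q]]]] := parts _ _ _ _ bQ hbv b'Q tb'v dQ dj td.
have s12 : s1 = s2.
  rewrite -tcd in s2p; apply: (path_sub_eq s1p s2p) => x xs.
  have xl := alive_tail x; have /andP[vl lc] := path_range s2p xs xl.
  have [y ys yl] : exists2 y, y \in s1 & alive y (tail x).
    by apply: path_alive s1p _; rewrite vl.
  by rewrite -(same (tail x) y x) ?s1P ?s2Q // -vE vl -tc.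
have passP : passes P v by apply/hasP; exists a'; rewrite ?eqxx.
have passQ : passes Q v by apply/hasP; exists b'; rewrite ?tb'v ?eqxx.
apply: (coh v) passP passQ _.
- by apply: contra_eq_neq vE => ->.
- apply/eqP => vn; have := tail_lt_head a'; have := ltn_ord (head a').
  by rewrite -/v vn /=; clear; lia.
left; split.
  exists p1, p2, [::], a, b; split=> //; first by rewrite hav hbv.
  by apply/(in_ltP hF (i := i)); rewrite // hav hbv.
exists s2, d, c, r2, r1; split=> //; first by rewrite -s12.
by apply/(out_ltP hF); rewrite // td.
Qed.

Lemma coherent_sym P Q : coherent F P Q -> coherent F Q P.
Proof.
by move=> coh v v0 vn Qv Pv [H|H]; apply: (coh v v0 vn Pv Qv); [right|left].
Qed.

Lemma route_le_coherent P Q : route_le P Q -> coherent F P Q.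
Proof.
have upto_sub S v e : e \in upto S v -> e \in (S : seq G) by rewrite mem_filter => /andP[].
have from_sub S v e : e \in from S v -> e \in (S : seq G) by rewrite mem_filter => /andP[].
move=> PQ v _ _ _ _ [[[p [q [s [a [b [pE qE hab lt_ab]]]]]] _]|[_]].
  have aP : a \in (P : seq G) by apply: (upto_sub _ v); rewrite pE mem_cat inE eqxx orbT.
  have bQ : b \in (Q : seq G) by apply: (upto_sub _ v); rewrite qE mem_cat inE eqxx orbT.
  pose i := (head a).-1.
  have ai : alive a i by rewrite /alive /i; have := tail_lt_head a; clear; lia.
  have bi : alive b i by rewrite /alive /i hab; have := tail_lt_head b; clear; lia.
  by move: lt_ab => /(in_ltP hF hab ai bi); rewrite ltNge (PQ _ _ _ aP bQ ai bi).
case=> s [a [b [p [q [pE qE tab lt_ab]]]]].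
have aP : a \in (P : seq G) by apply: (from_sub _ v); rewrite pE mem_cat inE eqxx orbT.
have bQ : b \in (Q : seq G) by apply: (from_sub _ v); rewrite qE mem_cat inE eqxx orbT.
move: lt_ab => /(out_ltP hF (esym tab)); rewrite ltNge (PQ _ _ _ aP bQ) ?alive_tail //.
by rewrite tab alive_tail.
Qed.

(** For plane framings incoherence means crossing. *)
Lemma coherentP P Q : coherent F P Q <-> route_le P Q \/ route_le Q P.
Proof.
split=> [coh|[/route_le_coherent //|/route_le_coherent/coherent_sym //]].
apply: contrapT => /not_orP[nPQ nQP].
have nle S T : ~ route_le S T -> exists i a b, [/\ a \in (S : seq G), b \in (T : seq G),
    alive a i, alive b i & cv b i < cv a i].
  move=> nST; apply: contrapT => no; apply: nST => i a b aS bT ai bi.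
  by rewrite leNgt; apply/negP => lt_ba; apply: no; exists i, a, b.
have [i [a [b [aP bQ ai bi lt_ba]]]] := nle _ _ nPQ.
have [j [d [c [dQ cP dj cj lt_cd]]]] := nle _ _ nQP.
have [ij|ji|ij] := ltngtP i j.
- apply: (crossing_incoherent ij) coh; first by exists a, b.
  by exists c, d.
- move/coherent_sym: coh; apply: (crossing_incoherent ji); first by exists d, c.
  by exists b, a.
subst j; move: lt_ba; rewrite -(route_alive_inj cP aP cj ai) -(route_alive_inj dQ bQ dj bi).
by rewrite ltNge ltW.
Qed.

End Routes.

(** * Maximal cliques grow by one bubble at a time *)

Section Cliques.
Context (R : realType) (n : nat) (G : flow_graph n) (D : embedding R G).
Context (F : framing G) (hF : induced_framing D F).
Implicit Types (e f g a b c k : G) (u v w : 'I_n.+1) (U L A B : seq G) (i j l : nat).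
Implicit Types (P Q S : route G) (C : {set route G}).
Local Notation cv := (cv D).
Local Notation route_le := (route_le D).
Local Notation ideal := (order_ideal D).

Lemma ideal_sub P Q : route_le P Q -> ideal P \subset ideal Q.
Proof.
move=> PQ; apply/fintype.subsetP => k /(order_idealP hF)[lk kP]; apply/(order_idealP hF).
split=> // b bQ bk; have [a aP ak] := route_alive P (alive_lt bk).
exact: le_trans (kP _ aP ak) (PQ _ _ _ aP bQ ak bk).
Qed.

Lemma ideal_proper P Q : route_le P Q -> P <> Q -> ideal P \proper ideal Q.
Proof.
move=> PQ /(route_diverge PQ)[a [b [aP bQ tab lt_ab]]].
apply/properP; split; first exact: ideal_sub.
have bi : alive b (tail a) by rewrite tab alive_tail.
exists b; first apply/(order_idealP hF).
  split=> [|c cQ ci]; first by apply/(level_gt0P hF); exists a; rewrite // -tab.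
  by rewrite -tab in ci *; rewrite (route_alive_inj cQ bQ ci bi).
apply/negP => /(order_idealP hF)[_] /(_ a aP); rewrite -tab alive_tail => /(_ isT).
by rewrite leNgt lt_ab.
Qed.

(** To add a bubble to the ideal of a route, replace its lower boundary in the
    route by its upper one.  No other bubble enters the ideal since the region
    swept by the route contains no edge. *)
Lemma route_flip Q k w U L : lens D (tail k) w (k :: U) L ->
  all (extreme D true) U -> bubble_at D k (k :: U) L ->
  {subset L <= (Q : seq G)} ->
  exists P A B, [/\ P = A ++ (k :: U) ++ B :> seq G, Q = A ++ L ++ B :> seq G,
    is_path ord0 A (tail k), route_le Q P /\ ideal P = (k |: ideal Q)%SET
    & forall S, route_le Q S ->
        (forall i a b, a \in k :: U -> b \in (S : seq G) -> alive a i -> alive b i ->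
           cv a i <= cv b i) -> route_le P S].
Proof.
move=> UL low bk LQ.
have [kw Up Lp] : [/\ (tail k < w)%N, is_path (tail k) (k :: U) w
  & is_path (tail k) L w] by case: UL.
have [A [B [QE Ap Bp]]] := path_subpath (routeP Q) Lp kw LQ.
have [P PE] := route_of_path (path_cat Ap (path_cat Up Bp)).
have UP : {subset k :: U <= (P : seq G)}.
  by move=> x xU; rewrite PE !mem_cat xU orbT.
(* outside of the bubble the routes agree, and inside each follows a boundary *)
have sides i a b : a \in (P : seq G) -> b \in (Q : seq G) -> alive a i -> alive b i ->
    a = b \/ [/\ a \in k :: U, b \in L & (tail k <= i < w)%N].
  move=> aP bQ ai bi; have [iuw|iuw] := boolP (tail k <= i < w)%N.
    have [c cU ci] := path_alive Up iuw; have [d dL di] := path_alive Lp iuw.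
    right; rewrite (route_alive_inj aP (UP _ cU) ai ci).
    by rewrite (route_alive_inj bQ (LQ _ dL) bi di).
  left; apply: (route_alive_inj (P := Q) _ bQ ai bi).
  move: aP; rewrite PE QE !mem_cat => /or3P[->//|aU|->]; last by rewrite !orbT.
  by rewrite (path_range Up aU ai) in iuw.
have QP : route_le Q P.
  move=> i b a bQ aP bi ai; case: (sides _ _ _ aP bQ ai bi) => [-> //|[aU bL _]].
  exact/ltW/(lens_sep UL).
exists P, A, B; split=> //; first split=> //; last first.
  move=> S QS US i a s aP sS ai si; have [b bQ bi] := route_alive Q (alive_lt ai).
  case: (sides _ _ _ aP bQ ai bi) => [->|[aU _ _]]; first exact: QS.
  exact: US.
have kP : k \in (P : seq G) by apply: UP; rewrite inE eqxx.
apply/eqP; rewrite finset.eqEsubset; apply/andP; split; last first.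
  apply/fintype.subsetP => g; rewrite in_setU1 => /predU1P[->|]; last first.
    exact: (fintype.subsetP (ideal_sub QP)).
  apply/(order_idealP hF); split; first exact: bubble_at_level bk.
  by move=> b bP bk'; rewrite (route_alive_inj bP kP bk' (alive_tail k)).
apply/fintype.subsetP => g /(order_idealP hF)[lg gP]; rewrite in_setU1.
have [//|gk /=] := eqVneq g k; apply/(order_idealP hF); split=> // b bQ bg.
have [a aP ag] := route_alive P (alive_lt bg).
case: (sides _ _ _ aP bQ ag bg) => [<-|[aU bL _]]; first exact: gP.
rewrite leNgt; apply/negP => lt_bg.
apply: (lens_void UL aU bL ag bg (alive_tail g)); rewrite lt_bg lt_neqAle gP // andbT.
apply/eqP => /(cv_inj (alive_tail g) ag) ga; subst a.
move: aU; rewrite inE (negPf gk) /= => /(low_level_all hF low) g0.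
by rewrite g0 in lg.
Qed.

(** At the last vertex at which a route can still turn upwards without rising
    above [P], the bubble above its leaving edge can be added: from then on the
    route follows topmost edges, like the lower boundary of this bubble. *)
Lemma bubble_between P Q : route_le Q P -> Q <> P -> exists k w U L,
  [/\ lens D (tail k) w (k :: U) L, all (extreme D true) U,
      bubble_at D k (k :: U) L, {subset L <= (Q : seq G)}
    & forall i a b, a \in k :: U -> b \in (P : seq G) -> alive a i -> alive b i ->
        cv a i <= cv b i].
Proof.
move=> QP neqQP; have [f0 [e0 [f0Q e0P fe0 lt0]]] := route_diverge QP neqQP.
pose turns (x : G * G) := [&& x.1 \in (Q : seq G), tail x.2 == tail x.1,
  cv x.1 (tail x.1) < cv x.2 (tail x.1) &
  [forall b, (b \in (P : seq G)) && alive b (tail x.1) ==>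
     (cv x.2 (tail x.1) <= cv b (tail x.1))]].
have turns0 : turns (f0, e0).
  apply/and4P; split=> //=; first by rewrite fe0.
  apply/forallP => b; apply/implyP => /andP[bP bi].
  by rewrite (route_alive_inj bP e0P bi) // fe0 alive_tail.
have [[f e] /and4P[/= fQ /eqP ef lt_fe /forallP eP] fmax] :=
  @arg_maxnP _ (f0, e0) turns (fun x => tail x.1 : nat) turns0.
pose above c := (tail c == tail f) && (cv f (tail f) < cv c (tail f)).
have above_e : above e by rewrite /above ef eqxx.
have [k /andP[/eqP kf lt_fk] kmin] :=
  @arg_minP _ R G e above (fun c => cv c (tail f)) above_e.
have kP b : b \in (P : seq G) -> alive b (tail k) -> cv k (tail k) <= cv b (tail k).
  rewrite kf => bP bf; apply: le_trans (kmin e above_e) _.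
  by have /implyP := eP b; apply; rewrite bP.
rewrite -kf in lt_fk.
have [c cf /andP[lt_fc lt_ck]|w [U [L [UL Ulow Lhigh]]]] := lens_exists (esym kf) lt_fk.
  have above_c : above c by rewrite /above -kf cf eqxx.
  by have /(_ c above_c) /= := kmin; rewrite -kf leNgt lt_ck.
have UP := extreme_path (lens_up UL) Ulow kP.
exists k, w, U, (f :: L); split=> //.
  by split; [exact: lens_bubble UL |].
have Lp := lens_low UL; have f_in : f \in f :: L by rewrite inE eqxx.
suff along i a b : a \in f :: L -> b \in (Q : seq G) -> alive a i -> alive b i -> a = b.
  move=> a aL; have [b bQ bi] := route_alive Q (alive_lt (alive_tail a)).
  by rewrite (along _ _ _ aL bQ (alive_tail a) bi).
move=> aL bQ ai bi; have /andP[ki _] := path_range Lp aL ai; move: ai bi.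
have fk : alive f (tail k) by rewrite kf alive_tail.
rewrite -(subnKC ki); elim: (i - tail k)%N a b aL bQ => [|j IHj] a b aL bQ.
  rewrite addn0 => ai bi; rewrite (path_alive_inj Lp aL f_in ai fk).
  exact: route_alive_inj fQ bQ fk bi.
rewrite addnS; set i0 := (tail k + j)%N in IHj * => ai bi.
have /andP[_ i1w] := path_range Lp aL ai.
have iuw : (tail k <= i0 < w)%N by rewrite leq_addr ltnW.
have [c cL ci] := path_alive Lp iuw; have [d dQ di] := route_alive Q (alive_lt ci).
have cd := IHj _ _ cL dQ ci di; subst d.
have ca := path_consecutive Lp cL aL ci ai; have cb := route_consecutive dQ bQ ci bi.
case: ca cb => [ca|[hc ta]] [cb|[hc' tb]].
- by rewrite -ca -cb.
- by move: ai; rewrite -ca /alive hc' ltnn andbF.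
- by move: bi; rewrite -cb /alive hc ltnn andbF.
have tab : tail b = tail a by apply/val_inj; rewrite /= ta tb.
apply/eqP/negPn/negP => ab.
have lt_ba : cv b i0.+1 < cv a i0.+1.
  rewrite lt_neqAle; apply/andP; split.
    by apply: contraNneq ab => /(cv_inj bi ai) ->.
  have /extremeP/(_ tab) : extreme D false a.
    move: aL; rewrite inE => /predU1P[af|/(allP Lhigh)//].
    by case/andP: iuw; rewrite kf -af ta ltnn.
  by rewrite ta.
have /fmax : turns (b, a).
  apply/and4P; split=> //=; first by rewrite tab.
    by rewrite tb.
  apply/forallP => s; apply/implyP => /andP[sP si]; rewrite tb in si *.
  have [g gU gi] := path_alive (lens_up UL) (path_range Lp aL ai).
  exact: le_trans (ltW (lens_sep UL gU aL gi ai)) (UP _ _ _ gU sP gi si).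
by rewrite /= tb -kf leqNgt ltnS; case/andP: iuw => ->.
Qed.

Lemma extreme_route (up : bool) : exists S : route G, forall P,
  if up then route_le S P else route_le P S.
Proof.
have [p pp pe] := path_to_sink ord0 (extreme_exists D up).
have [S SE] := route_of_path pp; exists S => P.
suff SP i a b : a \in (S : seq G) -> b \in (P : seq G) -> alive a i -> alive b i ->
    dir_le up (cv a i) (cv b i).
  by case: (up) SP => SP i a b; [exact: SP | move=> bP aS bi ai; exact: SP].
rewrite SE; case: p pp pe {SE} => [|e p] // pp /= /andP[ext_e ext_p].
apply: (extreme_path pp ext_p) => c cP ci; apply: extremeP ext_e _.
have te : tail e = ord0 by case/andP: pp => /eqP.
by apply/val_inj/eqP; rewrite te -leqn0; case/andP: ci; rewrite te.
Qed.

Lemma clique_total C P Q : maximal_clique F C -> P \in C -> Q \in C ->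
  route_le P Q \/ route_le Q P.
Proof. by move=> [cl _] PC QC; apply/(coherentP hF)/cl. Qed.

Lemma maximal_clique_mem C P : maximal_clique F C ->
  (forall Q, Q \in C -> route_le P Q \/ route_le Q P) -> P \in C.
Proof.
move=> [cl mx] cmp; suff <- : (P |: C)%SET = C by rewrite in_setU1 eqxx.
apply: mx; last exact: finset.subsetUr.
move=> S T; rewrite !in_setU1 => /predU1P[->|SC] /predU1P[->|TC].
- by apply/(coherentP hF); left; apply: route_le_refl.
- by apply/(coherentP hF)/cmp.
- by apply/coherent_sym/(coherentP hF)/cmp.
exact: cl.
Qed.

(** Between the last route of the clique below a bubble and the first one above
    it, flipping any bubble yields a route comparable to the whole clique: by
    maximality there is nothing else in between. *)
Lemma maximal_clique_flip C k : maximal_clique F C -> (0 < level F k)%N ->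
  exists P Q U L A B, [/\ Rup D C k = Some P, Rdown D C k = Some Q,
    bubble_at D k (k :: U) L /\ all (extreme D true) U
    & [/\ P \in C, Q \in C, P = A ++ (k :: U) ++ B :> seq G,
          Q = A ++ L ++ B :> seq G & is_path ord0 A (tail k)]].
Proof.
move=> mC lk.
have ideal_inj P Q : P \in C -> Q \in C -> ideal P = ideal Q -> P = Q.
  move=> PC QC eqI; apply: contrapT => neqPQ.
  have irr (X : {set G}) : X \proper X -> False by rewrite fintype.properE andbN.
  case: (clique_total mC PC QC) => [PQ|QP]; apply: (irr (ideal Q)).
    by rewrite -{1}eqI; apply: ideal_proper.
  by rewrite -{2}eqI; apply: ideal_proper => // /esym.
have [Bot BotP] := extreme_route true; have [Top TopP] := extreme_route false.
have BotC : Bot \in C by apply: maximal_clique_mem mC _ => Q _; left; apply: BotP.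
have TopC : Top \in C by apply: maximal_clique_mem mC _ => Q _; right; apply: TopP.
have kBot : k \notin ideal Bot.
  have /(level_gt0P hF)[f fk lt_fk] := lk; have [S fS] := route_through f.
  apply/negP => /(fintype.subsetP (ideal_sub (BotP S))) /(order_idealP hF)[_ /(_ f fS)].
  by rewrite -fk alive_tail fk => /(_ isT); rewrite leNgt lt_fk.
have kTop : k \in ideal Top.
  have [S kS] := route_through k; apply: (fintype.subsetP (ideal_sub (TopP S))).
  apply/(order_idealP hF); split=> // b bS bk.
  by rewrite (route_alive_inj bS kS bk (alive_tail k)).
have [Q /andP[QC kQ] Qmax] := @arg_maxnP _ Bot
  (fun S => (S \in C) && (k \notin ideal S)) (fun S => #|ideal S|) (introT andP (conj BotC kBot)).
have [P /andP[PC kP] Pmin] := @arg_minnP _ Top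
  (fun S => (S \in C) && (k \in ideal S)) (fun S => #|ideal S|) (introT andP (conj TopC kTop)).
have below S : S \in C -> k \notin ideal S -> route_le S Q.
  move=> SC kS; case: (clique_total mC SC QC) => // QS.
  have [->|/eqP neq] := eqVneq Q S; first exact: route_le_refl.
  have /proper_card := ideal_proper QS neq.
  by have /(_ (introT andP (conj SC kS))) := Qmax S; rewrite /= leqNgt => /negP.
have above S : S \in C -> k \in ideal S -> route_le P S.
  move=> SC kS; case: (clique_total mC SC PC) => // SP.
  have [->|/eqP neq] := eqVneq S P; first exact: route_le_refl.
  have /proper_card := ideal_proper SP neq.
  by have /(_ (introT andP (conj SC kS))) := Pmin S; rewrite /= leqNgt => /negP.
have neqQP : Q <> P by move=> QP; rewrite QP kP in kQ.
have QP : route_le Q P.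
  case: (clique_total mC QC PC) => // /ideal_sub/fintype.subsetP/(_ k kP) kQ'.
  by rewrite kQ' in kQ.
have [k' [w [U [L [UL low bk' LQ UP]]]]] := bubble_between QP neqQP.
have [S [A [B [SE QE Ap [QS IS] Smin]]]] := route_flip UL low bk' LQ.
have SP : route_le S P by apply: Smin.
have SC : S \in C.
  apply: maximal_clique_mem mC _ => T TC; have [kT|kT] := boolP (k \in ideal T).
    by left; apply: route_le_trans SP (above T TC kT).
  by right; apply: route_le_trans (below T TC kT) QS.
have kS : k \in ideal S.
  apply: contraT => kS; have SQ := route_le_anti (below S SC kS) QS.
  have : k' \in ideal S by rewrite IS in_setU1 eqxx.
  have bP : k' \in (S : seq G) by rewrite SE !mem_cat inE eqxx !orbT.
  rewrite SQ => /(order_idealP hF)[_ le_k'].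
  have [b bL bi] : exists2 b, b \in L & alive b (tail k').
    by apply: path_alive (lens_low UL) _; rewrite leqnn (lens_lt UL).
  have kU : k' \in k' :: U by rewrite inE eqxx.
  have := lens_sep UL kU bL (alive_tail k') bi.
  by rewrite ltNge le_k' // LQ.
have PS : P = S := route_le_anti (above S SC kS) SP.
have kk' : k = k'.
  by move: kS; rewrite IS in_setU1 (negPf kQ) orbF => /eqP.
subst k' S.
have precE : [set q | precedes D C q k]%SET = ideal Q.
  apply/setP => q; rewrite inE; apply/existsP/idP => [[T /and3P[TC qT kT]]|qQ].
    exact: (fintype.subsetP (ideal_sub (below T TC kT))).
  by exists Q; rewrite QC qQ.
have RupE : Rup D C k = Some P.
  rewrite /Rup; case: pickP => [T /andP[TC /eqP IT]|/(_ P)].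
    by congr Some; apply: ideal_inj => //; rewrite IT precE.
  by rewrite PC IS precE eqxx.
have RdownE : Rdown D C k = Some Q.
  have IPk : (ideal P :\ k)%SET = ideal Q by rewrite IS setU1K.
  rewrite /Rdown RupE; case: pickP => [T /andP[TC /eqP IT]|/(_ Q)].
    by congr Some; apply: ideal_inj => //; rewrite IT.
  by rewrite QC IPk eqxx.
by exists P, Q, U, L, A, B; split.
Qed.

End Cliques.

(** * Summation over descending bubbles *)

Section Forest.
Context (T : finType) (r : rel T).
Context (parent_unique : forall x y z, r x z -> r y z -> x = y).

(** Both paths to [z], read backwards, run through the same predecessors. *)
Lemma connect_common x y z : connect r x z -> connect r y z ->
  connect r x y \/ connect r y x.
Proof.
case/connectP=> p + ->; elim/last_ind: p => [|p t IHp] /=; first by right.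
rewrite rcons_path last_rcons => /andP[xp pt] /connectP[q].
elim/last_ind: q => [_ /= <-|q s _].
  left; apply/connectP; exists (rcons p t); last by rewrite last_rcons.
  by rewrite rcons_path xp.
rewrite rcons_path last_rcons => /andP[yq qs] ts; subst s.
by apply: IHp => //; rewrite (parent_unique pt qs); apply/connectP; exists q.
Qed.

Context (mu : T -> nat) (mu_lt : forall x y, r x y -> (mu y < mu x)%N).

Lemma connect_measure x y : connect r x y -> (mu y <= mu x)%N.
Proof.
case/connectP=> p + ->; elim: p x => //= z p IHp x /andP[/mu_lt xz /IHp zp].
exact: leq_trans zp (ltnW xz).
Qed.

(** Unique parents make the descendants of distinct children disjoint, and the
    decreasing measure excludes cycles. *)
Lemma sum_descendants (V : zmodType) (d : T -> V) x :
  \sum_(y | connect r x y) d y =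
  d x + \sum_(z | r x z) \sum_(y | connect r z y) d y.
Proof.
pose desc z : {set T} := if r x z then [set y | connect r z y]%SET else finset.set0.
have desc_disj i j : i != j -> [disjoint desc i & desc j]%B.
  move=> ij; rewrite /desc; case: ifP => [xi|_]; last by rewrite -setI_eq0 finset.set0I.
  case: ifP => [xj|_]; last by rewrite -setI_eq0 finset.setI0.
  rewrite -setI_eq0; apply/set0Pn => -[z]; rewrite !inE => /andP[iz jz].
  have sib a b : r x a -> r x b -> a != b -> connect r a b -> False.
    move=> xa xb ab /connectP[p]; elim/last_ind: p => [_ /= ba|p t _].
      by rewrite ba eqxx in ab.
    rewrite rcons_path last_rcons => /andP[ap pt] bt; subst t.
    have /connect_measure : connect r a x.
      by rewrite -(parent_unique pt xb); apply/connectP; exists p.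
    by rewrite leqNgt mu_lt.
  case: (connect_common iz jz); first exact: sib.
  by apply: sib; rewrite // eq_sym.
have xdesc : x \notin (\bigcup_z desc z)%SET.
  apply/finset.bigcupP => -[z _]; rewrite /desc; case: ifP => [xz|_]; rewrite inE //.
  by move/connect_measure; rewrite leqNgt mu_lt.
have -> : \sum_(y | connect r x y) d y = \sum_(y in (x |: \bigcup_z desc z)%SET) d y.
  apply: eq_bigl => y; rewrite in_setU1; apply/idP/predU1P => [|[-> //|]].
    case/connectP=> -[|z p] /= xp ->; first by left.
    case/andP: xp => xz zp; right; apply/finset.bigcupP; exists z => //.
    by rewrite /desc xz inE; apply/connectP; exists p.
  case/finset.bigcupP=> z _; rewrite /desc; case: ifP => [xz|_]; rewrite inE //.
  exact: connect_trans (connect1 xz).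
rewrite big_setU1 //=; congr (_ + _).
rewrite partition_disjoint_bigcup // [RHS]big_mkcond /=; apply: eq_bigr => z _.
rewrite /desc; case: ifP => _; last by rewrite big_set0.
by apply: eq_bigl => y; rewrite inE.
Qed.

End Forest.

(** * The coordinates of a vertex of the framingtope *)

Section Coordinates.
Context (R : realType) (n : nat) (G : flow_graph n) (D : embedding R G).
Context (F : framing G) (hF : induced_framing D F).
Implicit Types (e f g a b c k p q : G) (U L A B : seq G).
Implicit Types (P Q S : route G) (C : {set route G}).
Local Notation cv := (cv D).

Definition child p q : bool :=
  `[< share_edge_below D [pred g | (0 < level F g)%N] q p >].

Lemma childP k U L g : bubble_at D k U L ->
  child k g = (g \in L) && (0 < level F g)%N.
Proof. by move=> bk; apply/asboolP/andP => /(share_upper_edgeP hF g bk). Qed.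

Lemma child_bubble k g : child k g -> exists U L, bubble_at D k U L.
Proof. by move/asboolP=> [_ [_ [U [L [_ [_ bk _ _ _]]]]]]; exists U, L. Qed.

Lemma child_parent_unique p q g : child p g -> child q g -> p = q.
Proof.
move=> pg qg; have [U [L bp]] := child_bubble pg; have [U' [L' bq]] := child_bubble qg.
move: pg qg; rewrite (childP g bp) (childP g bq) => /andP[gL _] /andP[gL' _].
exact: bubble_lower_inj bp bq gL gL'.
Qed.

Lemma child_tail k g : child k g -> (tail k <= tail g)%N.
Proof.
move=> kg; have [U [L bk]] := child_bubble kg.
have [w [_ _ Lp _ _]] := bubble_at_paths bk.
by move: kg; rewrite (childP g bk) => /andP[/(path_mem_bounds Lp)[]].
Qed.

(** Moving downwards to a child, an edge gets later or lower. *)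
Definition edge_rank k : nat := #|[set e : G | (tail k < tail e)%N ||
  (tail e == tail k) && (cv e (tail k) < cv k (tail k))]%SET|.

Lemma child_rank k g : child k g -> (edge_rank g < edge_rank k)%N.
Proof.
move=> kg; have kg_tail := child_tail kg; have [U [L bk]] := child_bubble kg.
have [w [UE Up Lp _ sep]] := bubble_at_paths bk.
move: kg; rewrite (childP g bk) => /andP[gL _].
have same_tail : tail g = tail k -> cv g (tail k) < cv k (tail k).
  move=> gk; apply: sep gL (alive_tail k) _; first by rewrite UE inE eqxx.
  by rewrite -gk alive_tail.
have later : tail g != tail k -> (tail k < tail g)%N.
  by rewrite ltn_neqAle kg_tail andbT eq_sym.
apply/proper_card/properP; split; last first.
  exists g; rewrite inE; last by rewrite ltnn ltxx andbF.
  have [/same_tail -> | ne] := eqVneq (tail g) (tail k); first by rewrite orbT.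
  by rewrite later.
apply/fintype.subsetP => e; rewrite !inE => /orP[ge|/andP[/eqP eg lt_eg]].
  by rewrite (leq_ltn_trans kg_tail ge).
have [gk|ne] := eqVneq (tail g) (tail k).
  by rewrite eg gk eqxx (lt_trans _ (same_tail gk)) ?orbT // -gk.
by rewrite eg later.
Qed.

(** A descent through edges which are not bottommost is in particular a descent
    in the bubble poset, and it only reaches bubbles whose first upper edge is
    not bottommost. *)
Lemma DbarE k : (0 < level F k)%N -> Dbar D F k = [set q | connect child k q]%SET.
Proof.
move=> lk; apply/setP => q; rewrite !inE.
have -> : reaches_down D F k q = connect child k q by [].
apply/and3P/idP => [[]//|kq]; split=> //.
  case/connectP: kq => p; elim/last_ind: p => [_ -> //|p t _].
  rewrite rcons_path last_rcons => /andP[_ pt] ->.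
  have [U [L bk]] := child_bubble pt; by move: pt; rewrite (childP _ bk) => /andP[].
case/connectP: kq => p + ->; elim: p (k) => [|z p IHp] y /=.
  by rewrite /bubble_le connect0.
case/andP=> /asboolP[Uz [Lz [Uy [Ly [g [bz bly gz gy _]]]]]] /IHp.
move/connect_trans; apply; apply: connect1; apply/asboolP.
by exists Uz, Lz, Uy, Ly, g.
Qed.

Context (h : route G -> R) (C : {set route G}) (hC : maximal_clique F C).
Context (x : framed_index F -> R) (hx : forall P, P \in C -> attains h P x).

Definition coordinate e : R := oapp x 0 (insub e).

Lemma tropical_termE P : tropical_term h P x = - h P + \sum_(e <- P) coordinate e.
Proof.
rewrite /tropical_term; congr (_ + _).
rewrite [RHS]big_uniq ?(path_uniq (routeP P)) //= [RHS]big_mkcond /=.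
rewrite [RHS](bigID (index_pred F)) /= [X in _ = _ + X]big1 => [|e /negPf ne]; last first.
  by rewrite /coordinate insubF // if_same.
rewrite addr0 [RHS](reindex_omap (val : framed_index F -> G) insub) => [|e ie]; last first.
  by rewrite insubT.
apply: eq_big => [j|j _]; first by rewrite valK eqxx (valP j).
by rewrite /coordinate valK /=; case: ifP; rewrite ?mul1r ?mul0r.
Qed.

Definition height_jump k : R := oapp h 0 (Rup D C k) - oapp h 0 (Rdown D C k).

(** The two routes of the clique around the bubble start with the same source
    edge, so both attain the same minimum, and they differ only along the
    boundary of the bubble. *)
Lemma coordinate_step k : tail k != ord0 -> (0 < level F k)%N ->
  coordinate k = height_jump k + \sum_(g | child k g) coordinate g.
Proof.
move=> k0 lk; have [P [Q [U [L [A [B]]]]]] := maximal_clique_flip hF hC lk.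
case=> RP RQ [bk low] [PC QC PE QE Ap].
have coord0 g : level F g = 0%N -> coordinate g = 0.
  by move=> g0; rewrite /coordinate insubF // /index_pred g0 andbF.
have samehd : ohead P = ohead Q.
  rewrite PE QE; case: A Ap {PE QE} => //= /eqP k0'.
  by rewrite -k0' eqxx in k0.
have : tropical_term h P x = tropical_term h Q x.
  apply/le_anti/andP; split; first exact: hx PC _ (esym samehd).
  exact: hx QC _ samehd.
rewrite !tropical_termE PE QE !big_cat big_cons /=.
have -> : \sum_(e <- U) coordinate e = 0.
  by rewrite big_seq big1 // => e eU; exact: coord0 (low_level_all hF low eU).
have -> : \sum_(e <- L) coordinate e = \sum_(g | child k g) coordinate g.
  have [w [_ _ Lp _ _]] := bubble_at_paths bk.
  rewrite big_uniq ?(path_uniq Lp) //= (bigID (fun g => 0 < level F g)%N) /=.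
  rewrite [X in _ + X]big1 => [|g /andP[_]]; last by rewrite -leqNgt leqn0 => /eqP/coord0.
  by rewrite addr0; apply: eq_bigl => g; rewrite (childP g bk).
by rewrite /height_jump RP RQ /=; lra.
Qed.

(** Unfolding [coordinate_step] down to the bubbles without children collects
    every bubble of [Dbar] exactly once. *)
Lemma coordinate_sum k : tail k != ord0 -> (0 < level F k)%N ->
  coordinate k = \sum_(q in Dbar D F k) height_jump q.
Proof.
move=> + lk; rewrite DbarE //.
have [m] := ubnP (edge_rank k); elim: m k lk => // m IHm k lk km k0.
rewrite (eq_bigl (connect child k)) => [|q]; last by rewrite inE.
rewrite (sum_descendants child_parent_unique child_rank) coordinate_step //.
congr (_ + _); apply: eq_bigr => g kg.
rewrite IHm; first by apply: eq_bigl => q; rewrite inE.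
- have [U [L bk]] := child_bubble kg.
  by move: kg; rewrite (childP g bk) => /andP[].
- exact: leq_trans (child_rank kg) km.
have := child_tail kg; apply: contraTneq => ->.
by rewrite leqn0 -(inj_eq val_inj) in k0 *.
Qed.

End Coordinates.

Theorem theorem7p5 (R : realType) (n : nat) (G : flow_graph n) (F : framing G)
    (D : embedding R G) (hF : induced_framing D F)
    (h : route G -> R) (hh : admissible F h)
    (C : {set route G}) (hC : maximal_clique F C)
    (x : framed_index F -> R) (hx : framingtope_vertex_of h C x) (i : framed_index F) :
  x i = \sum_(k in Dbar D F (val i))
          (oapp h 0 (Rup D C k) - oapp h 0 (Rdown D C k)).
Proof.
have /andP[i0 li] := valP i.
have <- : coordinate x (val i) = x i by rewrite /coordinate valK.
exact: (coordinate_sum hF hC (proj2 hx)).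
Qed.
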